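(* If $f\in L^1_w(G)$ is of $w$-spectral synthesis with respect to a closed subset $\Delta$ of $\widehat G$, then $\gamma^{-1}(\phi*f)\in E_w^0(G,X)$ for all $\gamma\in\Delta$ and $\phi\in BUC_w(G,X)$.
   Context: $G$ is a compactly generated locally compact abelian group (written additively) with Haar measure $\mu$ and dual group $\widehat G$ (written multiplicatively); $X$ is a complex Banach space. $\phi_h(t)=\phi(t+h)$, $\Delta_h\phi=\phi_h-\phi$. The weight $w:G\to\mathbf R$ is a continuous function with $w\ge 1$, $w(s+t)\le w(s)w(t)$, $w(-t)=w(t)$, $\sum_{n\ge1}n^{-2}\log w(nt)<\infty$ for all $s,t\in G$; $w=1$ or $1/w\in C_0(G)$; $\Delta_hw/w\in C_0(G)$ for every $h\in G$; and $\sup_{t\in G}|\Delta_hw(t)|/w(t)\to0$ as $h\to0$. (A bounded weight is assumed to be $1$.) $BC_w(G,X)$ is the Banach space of continuous $\phi:G\to X$ with $\|\phi\|_{w,\infty}=\sup_{t\in G}\|\phi(t)\|/w(t)<\infty$; $BUC_w(G,X)$ is its closed subspace of functions with $\|\Delta_h\phi\|_{w,\infty}\to0$ as $h\to0$. $L^1_w(G)$ is the Banach algebra (under convolution) of measurable $f:G\to\mathbf C$ with $\|f\|_{w,1}=\int_G|f|w\,d\mu<\infty$; $\widehat f(\gamma)=\int_G\gamma(-t)f(t)\,d\mu(t)$; $\phi*f(t)=\int_G\phi(t-s)f(s)\,d\mu(s)$. $E_w^0(G,X)$ is the space of $\phi\in BC_w(G,X)$ such that for each $\varepsilon>0$ there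 is a finite $F\subseteq G$ with $\sup_{s\in G}\|\frac1{|F|}\sum_{t\in F}(\phi/w)(s+t)\|<\varepsilon$. $f\in L^1_w(G)$ is of $w$-spectral synthesis with respect to a closed $\Delta\subseteq\widehat G$ if there is a sequence $(f_n)$ in $L^1_w(G)$ converging to $f$ in $L^1_w(G)$ with $\widehat{f_n}=0$ on a neighbourhood $U_n$ of $\Delta$ for each $n$. *)

(* Defs.v *)
From HB Require Import structures.
From mathcomp Require Import all_boot all_order all_algebra.
From mathcomp Require Import finmap.
From mathcomp Require Import complex.
From mathcomp Require Import all_classical all_reals all_analysis.

Set Implicit Arguments.
Unset Strict Implicit.
Unset Printing Implicit Defensive.

Import Order.TTheory GRing.Theory Num.Theory.
Import numFieldNormedType.Exports.
Local Open Scope classical_set_scope.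
Local Open Scope ring_scope.
Local Open Scope complex_scope.

(* The norm of a normed space over R[i] takes values in R[i]; normR is the same
   number seen in R. *)
Definition normR {R : realType} {V : normedZmodType R[i]} (v : V) : R :=
  complex.Re `|v|.

(* [compact], [locally_compact] do not include separation, hence the separate
   Hausdorff clause in is_LCA. *)
Definition is_LCA (G : topologicalZmodType) : Prop :=
  hausdorff_space G /\ locally_compact [set: G].

Definition is_subgroup (G : zmodType) (H : set G) : Prop :=
  H 0 /\ forall x y, H x -> H y -> H (x - y).

Definition compactly_generated (G : topologicalZmodType) : Prop :=
  exists2 K : set G, compact K & smallest (@is_subgroup G) K = [set: G].

(* g_sigma_algebraType wants a pointedType, which a topologicalZmodType is not;
   carrier G is G pointed by 0. *)
Definition carrier (G : topologicalZmodType) : Type := G.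
HB.instance Definition _ (G : topologicalZmodType) := Choice.on (carrier G).
HB.instance Definition _ (G : topologicalZmodType) :=
  isPointed.Build (carrier G) (0 : G).

Notation borel G :=
  (g_sigma_algebraType (@open G : set (set (carrier G)))).

Section Haar.
Context {R : realType} {G : topologicalZmodType}.
Local Open Scope ereal_scope.

Record is_haar (mu : {measure set (borel G) -> \bar R}) : Prop := {
  haar_invariant : forall (A : set (borel G)) (t : G), measurable A ->
    mu [set (t + x)%R | x in (A : set G)] = mu A ;
  haar_compact : forall K : set G, compact K -> mu K < +oo ;
  haar_outer_regular : forall A : set (borel G), measurable A ->
    mu A = ereal_inf [set mu U | U in [set U : set G | open U /\ A `<=` U]] ;
  haar_inner_regular : forall U : set G, open U ->
    mu U = ereal_sup [set mu K | K in [set K : set G | compact K /\ K `<=` U]] ;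
  haar_nonzero : mu setT != 0 }.
End Haar.

Section Bochner.
Context {d : measure_display} {T : measurableType d} {R : realType}.
Context {X : normedModType R[i]}.
Variable mu : {measure set T -> \bar R}.

Definition bochner_simple (s : T -> X) : Prop :=
  finite_set (range s) /\
  forall x : X, measurable (s @^-1` [set x]) /\
    (x != 0 -> (mu (s @^-1` [set x]) < +oo)%E).

Definition simple_integral (s : T -> X) : X :=
  \sum_(x \in range s) ((fine (mu (s @^-1` [set x])))%:C *: x).

(* The simple functions converge everywhere, not just almost everywhere, so that
   F - s n has a measurable norm without completing mu. *)
Definition is_bochner_integral (F : T -> X) (v : X) : Prop :=
  exists s : nat -> T -> X,
    [/\ forall n, bochner_simple (s n),
        forall t, s n t @[n --> \oo] --> F t,
        (\int[mu]_t (normR (F t - s n t))%:E)%E @[n --> \oo] --> 0%E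
      & simple_integral (s n) @[n --> \oo] --> v].

(* 0 when F is not Bochner integrable *)
Definition bochner_integral (F : T -> X) : X :=
  xget 0 [set v | is_bochner_integral F v].
End Bochner.

Definition complex_integral {d : measure_display} {T : measurableType d}
    {R : realType} (mu : {measure set T -> \bar R}) (f : T -> R[i]) : R[i] :=
  (\int[mu]_t complex.Re (f t)) +i* (\int[mu]_t complex.Im (f t)).

Section Dual.
Variables (R : realType) (G : topologicalZmodType).

Definition is_character (gamma : G -> R[i]^o) : Prop :=
  [/\ continuous gamma,
      forall s t, gamma (s + t) = gamma s * gamma t
    & forall t, `|gamma t| = 1].

(* set_type carries the subspace topology, here that of uniform convergence on
   compact sets. *)
Definition dual_group :=
  set_type [set gamma : {compact-open, G -> R[i]^o} | is_character gamma].

Definition dual_fun (gamma : dual_group) : G -> R[i] := set_val gamma.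
End Dual.
Coercion dual_fun : dual_group >-> Funclass.

Section Weighted.
Context {R : realType} {G : topologicalZmodType}.

Definition translate {Y : Type} (h : G) (phi : G -> Y) : G -> Y :=
  fun t => phi (t + h).
Definition difference {Y : zmodType} (h : G) (phi : G -> Y) : G -> Y :=
  fun t => translate h phi t - phi t.

Definition is_C0 (g : G -> R) : Prop :=
  continuous g /\
  forall e : R, 0 < e ->
    exists2 K : set G, compact K & forall t, ~ K t -> `|g t| < e.

Record is_weight (w : G -> R) : Prop := {
  weight_continuous : continuous w ;
  weight_ge1 : forall t, 1 <= w t ;
  weight_submul : forall s t, w (s + t) <= w s * w t ;
  weight_sym : forall t, w (- t) = w t ;
  weight_nonquasianalytic : forall t,
    (\sum_(1 <= n <oo) (n%:R ^- 2 * ln (w (t *+ n)))%:E < +oo)%E ;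
  weight_one_or_C0 : (forall t, w t = 1) \/ is_C0 (fun t => 1 / w t) ;
  weight_difference_C0 : forall h, is_C0 (fun t => difference h w t / w t) ;
  weight_difference_small :
    ereal_sup [set (`|difference h w t| / w t)%:E | t in [set: G]]
      @[h --> (0 : G)] --> 0%E ;
  (* follows from weight_one_or_C0 unless G is compact *)
  weight_bounded : (exists M : R, forall t, w t <= M) -> forall t, w t = 1 }.

Section Functions.
Context {X : normedModType R[i]}.
Variable w : G -> R.

Definition wsup_norm (phi : G -> X) : \bar R :=
  ereal_sup [set (normR (phi t) / w t)%:E | t in [set: G]].

Definition BC_w (phi : G -> X) : Prop :=
  continuous phi /\ (wsup_norm phi < +oo)%E.

Definition BUC_w (phi : G -> X) : Prop :=
  BC_w phi /\ wsup_norm (difference h phi) @[h --> (0 : G)] --> 0%E.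

Definition E0_w (phi : G -> X) : Prop :=
  BC_w phi /\
  forall e : R, 0 < e ->
    exists2 F : {fset G}, F != fset0 &
      (ereal_sup [set (normR ((#|` F|%:R : R[i])^-1 *:
          \sum_(t <- F) ((w (s + t))%:C^-1 *: phi (s + t))))%:E
        | s in [set: G]] < e%:E)%E.
End Functions.

Section Group_algebra.
Variables (mu : {measure set (borel G) -> \bar R}) (w : G -> R).

Definition w1_norm (f : G -> R[i]) : \bar R :=
  (\int[mu]_t (normR (f t) * w t)%:E)%E.

Definition L1_w (f : G -> R[i]) : Prop :=
  [/\ measurable_fun setT ((fun t => complex.Re (f t)) : borel G -> R),
      measurable_fun setT ((fun t => complex.Im (f t)) : borel G -> R)
    & (w1_norm f < +oo)%E].

Definition fourier (f : G -> R[i]) (gamma : dual_group R G) : R[i] :=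
  complex_integral mu (fun t => gamma (- t) * f t).

Definition convolution {X : normedModType R[i]} (phi : G -> X) (f : G -> R[i]) :
  G -> X := fun t => bochner_integral mu (fun s => f s *: phi (t - s)).

Definition spectral_synthesis (f : G -> R[i]) (Delta : set (dual_group R G)) :
  Prop := exists fn : nat -> G -> R[i],
    [/\ forall n, L1_w (fn n),
        w1_norm (fun t => fn n t - f t) @[n --> \oo] --> 0%E
      & forall n, exists2 U : set (dual_group R G), set_nbhs Delta U &
          forall gamma, U gamma -> fourier (fn n) gamma = 0].
End Group_algebra.
End Weighted.

(* Main.v *)
(* Spectral synthesis enters through \hat f(gamma) = 0, which passes from the f_n
   to their L^1_w-limit. Multiplying f and phi by gamma^-1
   reduces everything to the trivial character, i.e. to \int f = 0.

   As phi is w-uniformly continuous and G is sigma-compact, f can be replaced,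
   uniformly in y, by a finite combination of point masses:
     phi * f (y) = \sum_j c_j phi(y - x_j) + O(e w(y)),  |\sum_j c_j| <= e.
   Put Psi = phi / w, a bounded function. Since the w(. - x_j) / w tend to 1 at
   infinity, (phi * f) / w differs from \sum_j c_j Psi(. - x_j) by O(e) off a
   compact set K, and K can be taken empty if w = 1.
   Boxes generated by the x_j grow polynomially, so one of them is a Folner set:
   its averages of Psi(. - x_j) and of Psi almost agree, and the average of the
   sum is close to (\sum_j c_j) times that of Psi, hence small. If K is not
   empty then G is not compact, and a union of many far apart translates of the
   Folner set has the same property and meets each translate of K in only a
   small proportion of its points. *)
Require Import Defs.
From HB Require Import structures.
From mathcomp Require Import all_boot all_order all_algebra.
From mathcomp Require Import finmap.
From mathcomp Require Import complex.
From mathcomp Require Import all_classical all_reals all_analysis.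
From mathcomp Require Import measurable_realfun ring lra.
Import Order.TTheory GRing.Theory Num.Theory.
Import numFieldNormedType.Exports.
Import HBNNSimple.
Local Open Scope classical_set_scope.
Local Open Scope ring_scope.
Local Open Scope complex_scope.

Set Implicit Arguments.
Unset Strict Implicit.
Unset Printing Implicit Defensive.

(** * The real-valued norm *)

Section NormR.
Context {R : realType}.

Lemma normRE (V : normedZmodType R[i]) (v : V) : `|v| = (normR v)%:C.
Proof. by rewrite /normR RRe_real ?normr_real. Qed.

Lemma normR_ge0 (V : normedZmodType R[i]) (v : V) : 0 <= normR v.
Proof. by rewrite -lecR -normRE; exact: normr_ge0. Qed.

Lemma normRD (V : normedZmodType R[i]) (u v : V) :
  normR (u + v) <= normR u + normR v.
Proof. by rewrite -lecR rmorphD /= -!normRE ler_normD. Qed.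

Lemma normRN (V : normedZmodType R[i]) (v : V) : normR (- v) = normR v.
Proof. by rewrite /normR normrN. Qed.

Lemma normRB (V : normedZmodType R[i]) (u v : V) :
  normR (u - v) <= normR u + normR v.
Proof. by rewrite -(normRN v) normRD. Qed.

Lemma normR_distC (V : normedZmodType R[i]) (u v : V) :
  normR (u - v) = normR (v - u).
Proof. by rewrite /normR distrC. Qed.

Lemma normR0 (V : normedZmodType R[i]) : normR (0 : V) = 0.
Proof. by rewrite /normR normr0. Qed.

Lemma normR_eq0 (V : normedZmodType R[i]) (v : V) : (normR v == 0) = (v == 0).
Proof. by rewrite -(inj_eq (@complexI R)) -normRE normr_eq0. Qed.

Lemma normR_triangle (V : normedZmodType R[i]) (u v x : V) :
  normR (u - v) <= normR (u - x) + normR (x - v).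
Proof. by rewrite -[u - v](subrKA x) normRD. Qed.

Lemma normR_sum (V : normedZmodType R[i]) (I : Type) (r : seq I) (P : pred I)
  (F : I -> V) :
  normR (\sum_(i <- r | P i) F i) <= \sum_(i <- r | P i) normR (F i).
Proof.
elim/big_ind2 : _ => [|x y u v xy uv|//]; first by rewrite normR0.
by rewrite (le_trans (normRD _ _))// lerD.
Qed.

Lemma normRZ (X : normedModType R[i]) (c : R[i]) (v : X) :
  normR (c *: v) = normR c * normR v.
Proof. by apply: complexI; rewrite rmorphM /= -!normRE normrZ. Qed.

Lemma normRM (c d : R[i]) : normR (c * d) = normR c * normR d.
Proof. by apply: complexI; rewrite rmorphM /= -!normRE normrM. Qed.

Lemma normRV (c : R[i]) : normR c^-1 = (normR c)^-1.
Proof. by apply: complexI; rewrite fmorphV /= -!normRE normfV. Qed.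

Lemma normR_real (x : R) : normR (x%:C) = `|x|.
Proof. by rewrite /normR normc_def /= expr0n addr0 sqrtr_sqr. Qed.

Lemma normR_Re (z : R[i]) : `|complex.Re z| <= normR z.
Proof. by rewrite -lecR -normRE normc_ge_Re. Qed.

Lemma normR_Im (z : R[i]) : `|complex.Im z| <= normR z.
Proof.
by rewrite /normR normc_def /= -sqrtr_sqr ler_wsqrtr// lerDr sqr_ge0.
Qed.

Lemma normR_ReIm (z : R[i]) : normR z <= `|complex.Re z| + `|complex.Im z|.
Proof.
rewrite {1}[z]complexE (le_trans (normRD _ _))// normRM !normR_real.
by rewrite {1}/normR normc_def /= expr0n expr1n add0r sqrtr1 mul1r.
Qed.

(** Balls of [X] have radii in [R[i]]; a positive element of [R[i]] is real, so real radii suffice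
    to test convergence. *)
Lemma cvg_normRP (X : normedModType R[i]) (T : Type) (F : set_system T)
    {FF : Filter F} (u : T -> X) (l : X) :
  (u @ F --> l) <-> (normR (u t - l) @[t --> F] --> (0 : R)).
Proof.
split=> ul.
  apply/(@cvgrPdist_lt _ _ _ F FF) => e e0.
  have /(@cvgrPdist_lt _ _ _ F FF)/(_ _ (eqbRL (ltcR 0 e) e0)) := ul.
  apply: filterS => t; rewrite normRE ltcR sub0r normrN normR_distC.
  by rewrite ger0_norm // normR_ge0.
apply/(@cvgrPdist_lt _ _ _ F FF) => e e0.
have /gtr0_real/complex_realP[r er] := e0.
move: e0; rewrite er ltcR => r0.
move/(@cvgrPdist_lt _ _ _ F FF)/(_ _ r0): ul; apply: filterS => t.
by rewrite normRE ltcR sub0r normrN normR_distC ger0_norm // normR_ge0.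
Qed.

Lemma cvg_normR (X : normedModType R[i]) (T : Type) (F : set_system T)
    {FF : Filter F} (u : T -> X) (l : X) :
  u @ F --> l -> normR (u t) @[t --> F] --> normR l.
Proof.
move=> /cvg_normRP/(@cvgrPdist_lt _ _ _ F FF) ul.
apply/(@cvgrPdist_lt _ _ _ F FF) => e /ul; apply: filterS => t.
rewrite sub0r normrN ger0_norm ?normR_ge0// => /le_lt_trans; apply.
have h1 := normRD (u t - l) l; have h2 := normRD (l - u t) (u t).
move: h1 h2; rewrite !subrK (normR_distC l) => h1 h2.
by rewrite ler_norml; apply/andP; split; [rewrite lerNl opprB lerBlDr|rewrite lerBlDr].
Qed.

Lemma normR_cauchy_cvg (X : completeNormedModType R[i]) (u : nat -> X) :
  (forall e : R, 0 < e -> exists N, forall m n, (N <= m)%N -> (N <= n)%N ->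
     normR (u m - u n) <= e) ->
  cvg (u @ \oo).
Proof.
move=> h; apply/cauchy_cvgP/cauchyP => e e0.
have /gtr0_real/complex_realP[r er] := e0.
move: e0; rewrite er ltcR => r0.
have [N hN] := h (r / 2) (divr_gt0 r0 (ltr0n _ 2)).
exists (u N); exists N => // n /= Nn.
rewrite -ball_normE /= normRE ltcR (le_lt_trans (hN _ _ _ _))//.
by rewrite ltr_pdivrMr// ltr_pMr// ltr1n.
Qed.

End NormR.

(** * Finite-valued measurable maps and the Bochner integral *)

Section FiniteMap.
Context {d : measure_display} {T : measurableType d}.

(** [Y] carries no sigma-algebra: with a finite range, measurable fibres make every preimage
    measurable. Hence such maps can be paired, and composed with arbitrary functions. *)
Definition finite_map (Y : Type) (q : T -> Y) : Prop :=
  finite_set (range q) /\ forall y, measurable (q @^-1` [set y]).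

Lemma finite_map_measurable (Y : Type) (q : T -> Y) (A : set Y) :
  finite_map q -> measurable (q @^-1` A).
Proof.
move=> [fq mq].
have -> : q @^-1` A = \bigcup_(y in range q `&` A) q @^-1` [set y].
  apply/seteqP; split => x /=; first by move=> Aqx; exists (q x) => //; split.
  by move=> [y [_ Ay] /= ->].
by apply: fin_bigcup_measurable => [|y _ //]; apply: finite_setIl.
Qed.

Lemma finite_map_comp (Y Z : Type) (u : Y -> Z) (q : T -> Y) :
  finite_map q -> finite_map (u \o q).
Proof.
move=> fq; have [fr _] := fq; split.
  by rewrite -(image_comp q u setT); exact: finite_image.
by move=> z; apply: (finite_map_measurable (u @^-1` [set z]) fq).
Qed.

Lemma finite_map_pair (Y Z : Type) (p : T -> Y) (q : T -> Z) :
  finite_map p -> finite_map q -> finite_map (fun x => (p x, q x)).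
Proof.
move=> [fp mp] [fq mq]; split.
  apply: (sub_finite_set _ (finite_setX fp fq)).
  by move=> _ [x _ <-]; split; exists x.
move=> [y z].
have -> : (fun x => (p x, q x)) @^-1` [set (y, z)] =
    p @^-1` [set y] `&` q @^-1` [set z].
  by apply/seteqP; split => x /= [-> ->].
exact: measurableI.
Qed.

Lemma finite_map_cst (Y : Type) (y : Y) : finite_map (cst y : T -> Y).
Proof.
split; first by apply: (sub_finite_set _ (finite_set1 y)) => _ [x _ <-].
by move=> z; rewrite preimage_cst; case: ifP.
Qed.

Lemma finite_map_asbool (A : set T) :
  measurable A -> finite_map (fun x => `[< A x >]).
Proof.
move=> mA; split; first exact: finite_finset.
move=> b; have -> : (fun x => `[< A x >]) @^-1` [set b] = if b then A else ~` A.
  apply/seteqP; split => x /=; case: b => /=.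
  - by move/asboolP.
  - by move=> /asboolP.
  - by move=> /asboolP.
  - by move=> nA; apply/asboolP.
by case: b => //; exact: measurableC.
Qed.

Lemma finite_map_if (Y : Type) (A : set T) (p q : T -> Y) :
  measurable A -> finite_map p -> finite_map q ->
  finite_map (fun x => if `[< A x >] then p x else q x).
Proof.
move=> mA fp fq.
exact: (finite_map_comp (fun z : bool * (Y * Y) => if z.1 then z.2.1 else z.2.2)
  (finite_map_pair (finite_map_asbool mA) (finite_map_pair fp fq))).
Qed.

Lemma finite_map_fun (R : realType) (q : T -> R) :
  finite_map q -> measurable_fun setT q.
Proof. by move=> fq _ A _; rewrite setTI; exact: finite_map_measurable. Qed.

End FiniteMap.

(** * Integrals of simple functions *)

Section SimpleIntegral.
Context {d : measure_display} {T : measurableType d} {R : realType}.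
Variable mu : {measure set T -> \bar R}.

(** The sum runs over the fibres of [q] and not over the level sets of [u \o q], so that several [u]
    can be integrated over one partition. *)
Lemma ge0_integral_finite_map (Y : choiceType) (q : T -> Y) (u : Y -> R) :
  finite_map q -> (forall y, 0 <= u y) ->
  (\int[mu]_x (u (q x))%:E = \sum_(y \in range q) (u y)%:E * mu (q @^-1` [set y]))%E.
Proof.
move=> fq u0; have [fr mq] := fq.
transitivity (\int[mu]_x \sum_(y \in range q) ((u y)%:E * (\1_(q @^-1` [set y]) x)%:E))%E.
  apply: eq_integral => x _.
  rewrite (fsbigD1 (q x))/=; last 2 first.
  - by [].
  - by exists x.
  rewrite fsbig1 ?adde0; last first.
    move=> y [_ /= yq]; rewrite indicE memNset ?mule0//= => qy.
    by apply: yq.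
  by rewrite indicE mem_set// mule1.
rewrite ge0_integral_fsum//.
- apply: eq_fsbigr => y _; rewrite ge0_integralZl//.
  + by rewrite integral_indic// setIT.
  + exact/measurable_EFinP/measurable_indic.
  + by rewrite lee_fin.
- by move=> y; apply/measurable_EFinP; apply: measurable_funM => //; exact: measurable_indic.
- by move=> y x _; rewrite mule_ge0// lee_fin.
Qed.

Context {X : normedModType R[i]}.

Lemma bochner_simple_comp (Y : choiceType) (q : T -> Y) (u : Y -> X) :
  finite_map q -> (forall y, u y != 0 -> (mu (q @^-1` [set y]) < +oo)%E) ->
  bochner_simple mu (u \o q).
Proof.
move=> fq uf; have [fr mq] := fq; have [h1 h2] := finite_map_comp u fq; split => // x.
split => // x0.
have -> : (u \o q) @^-1` [set x] = \bigcup_(y in range q `&` u @^-1` [set x]) q @^-1` [set y].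
  apply/seteqP; split => t /=; first by move=> ut; exists (q t) => //; split.
  by move=> [y [_ /= <-] /= ->].
rewrite measure_fin_bigcup//; last 2 first.
- exact: finite_setIl.
- by move=> y z _ _ [t [/= <- <-]].
rewrite fsbig_finite; last exact: finite_setIl.
rewrite big_seq; apply: lte_sum_pinfty => y; rewrite in_fset_set ?inE; last exact: finite_setIl.
by move=> -[_ /= uy]; apply: uf; rewrite uy.
Qed.

Lemma bochner_simple_finite_map (s : T -> X) : bochner_simple mu s -> finite_map s.
Proof. by move=> [? h]; split => // y; case: (h y). Qed.

(** Grouping the fibres of [q] by the value of [u] turns the sum over values, which defines the
    integral, into a sum over fibres. *)
Lemma simple_integral_comp (Y : choiceType) (q : T -> Y) (u : Y -> X) :
  finite_map q -> (forall y, u y != 0 -> (mu (q @^-1` [set y]) < +oo)%E) ->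
  simple_integral mu (u \o q) =
  \sum_(y \in range q) ((fine (mu (q @^-1` [set y])))%:C *: u y).
Proof.
move=> fq uf; have [fr mq] := fq.
rewrite /simple_integral [in RHS]fsbig_finite// (partition_big_imfset _ u)/=.
have fru : finite_set (range (u \o q)) by have [] := finite_map_comp u fq.
rewrite fsbig_finite//.
have -> : fset_set (range (u \o q)) = [fset u y | y in fset_set (range q)]%fset.
  apply/fsetP => x; rewrite in_fset_set//; apply/idP/imfsetP => /=.
    by rewrite inE => -[t _ <-]; exists (q t) => //; rewrite in_fset_set// inE; exists t.
  by move=> [y + ->]; rewrite in_fset_set// !inE => -[t _ <-]; exists t.
apply: eq_bigr => x _.
(* The level set of 0 may have infinite measure, where [fine] is not additive; both sides vanish
   there. *)
have [->|x0] := eqVneq x 0.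
  by rewrite scaler0 big1// => y /eqP ->; rewrite scaler0.
under [RHS]eq_bigr => y /eqP yx do rewrite yx.
rewrite -scaler_suml -rmorph_sum /=; congr (_%:C *: _).
have -> : (u \o q) @^-1` [set x] =
    \bigcup_(y in range q `&` u @^-1` [set x]) q @^-1` [set y].
  apply/seteqP; split => t /=; first by move=> ut; exists (q t) => //; split.
  by move=> [y [_ /= <-] /= ->].
rewrite measure_fin_bigcup//; last 2 first.
- exact: finite_setIl.
- by move=> y z _ _ [t [/= <- <-]].
rewrite (fsbigE [seq y <- fset_set (range q) | u y == x]); last 3 first.
- exact/filter_uniq/fset_uniq.
- move=> y /=; rewrite mem_filter => /andP[/eqP uy].
  by rewrite in_fset_set// inE.
- move=> y [yq uy]; rewrite mem_filter in_fset_set// uy eqxx mem_set//.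
rewrite big_filter_cond /= sum_fine => [|y /eqP yx]; last first.
  by rewrite ge0_fin_numE ?measure_ge0//; apply: uf; rewrite yx.
rewrite big_seq_cond [in RHS]big_seq_cond; congr (fine _).
apply: eq_bigl => y.
case: (boolP (y \in fset_set _)) => //=; rewrite in_fset_set// inE => yq.
by case: eqP => //= uy; rewrite mem_set.
Qed.

Lemma simple_integralZ (c : R[i]) (s : T -> X) : bochner_simple mu s ->
  bochner_simple mu (fun x => c *: s x) /\
  simple_integral mu (fun x => c *: s x) = c *: simple_integral mu s.
Proof.
move=> bs; have fs := bochner_simple_finite_map bs.
have h y : c *: y != 0 -> (mu (s @^-1` [set y]) < +oo)%E.
  by have [_ /(_ y)[_ +]] := bs; move=> + cy; apply; apply: contraNneq cy => ->; rewrite scaler0.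
have h2 y : (id : X -> X) y != 0 -> (mu (s @^-1` [set y]) < +oo)%E.
  by have [_ /(_ y)[_ +]] := bs.
split; first exact: (bochner_simple_comp fs h).
rewrite (simple_integral_comp fs h) (simple_integral_comp fs h2).
rewrite !fsbig_finite; [|by case: fs..].
by rewrite scaler_sumr; apply: eq_bigr => y _; rewrite !scalerA mulrC.
Qed.

Lemma bochner_simple_measurableB (s s' : T -> X) :
  bochner_simple mu s -> bochner_simple mu s' ->
  measurable_fun setT (fun x => normR (s x - s' x)).
Proof.
move=> /bochner_simple_finite_map fs /bochner_simple_finite_map fs'.
apply: finite_map_fun.
exact: (finite_map_comp (fun z => normR (z.1 - z.2)) (finite_map_pair fs fs')).
Qed.

(** Over the common fibres of the pair [(s, s')] this is the triangle inequality for a finite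
    sum. *)
Lemma le_simple_integralB (s s' : T -> X) :
  bochner_simple mu s -> bochner_simple mu s' ->
  ((normR (simple_integral mu s - simple_integral mu s'))%:E <=
   \int[mu]_x (normR (s x - s' x))%:E)%E.
Proof.
move=> bs bs'.
have fq := finite_map_pair (bochner_simple_finite_map bs) (bochner_simple_finite_map bs').
set q := (fun x => (s x, s' x)) in fq; have [fr mq] := fq.
have [[_ fs] [_ fs']] := (bs, bs').
have h1 y : y.1 != 0 -> (mu (q @^-1` [set y]) < +oo)%E.
  move=> /(proj2 (fs _)); apply: le_lt_trans; apply: le_measure; rewrite ?inE//.
    exact: (fs _).1.
  by move=> x /= <-.
have h2 y : y.2 != 0 -> (mu (q @^-1` [set y]) < +oo)%E.
  move=> /(proj2 (fs' _)); apply: le_lt_trans; apply: le_measure; rewrite ?inE//.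
    exact: (fs' _).1.
  by move=> x /= <-.
rewrite (simple_integral_comp fq h1) (simple_integral_comp fq h2).
rewrite (ge0_integral_finite_map fq (u := fun z => normR (z.1 - z.2))); last first.
  by move=> y; exact: normR_ge0.
rewrite !fsbig_finite// -sumrB.
apply: (@le_trans _ _ (\sum_(y <- fset_set (range q))
    (fine (mu (q @^-1` [set y])) * normR (y.1 - y.2))%:E)%E).
  rewrite sumEFin lee_fin; apply: le_trans (normR_sum _ _ _) _.
  apply: ler_sum => y _; rewrite -scalerBr normRZ normR_real ger0_norm// fine_ge0.
apply: lee_sum => y _.
(* A fibre on which the two values agree may have infinite measure but contributes 0; on any other
   fibre one value is nonzero, so its measure is finite. *)
have [->|y12] := eqVneq y.1 y.2; first by rewrite subrr normR0 mulr0 mul0e.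
rewrite EFinM muleC fineK// ge0_fin_numE ?measure_ge0//.
have [y10|] := eqVneq y.1 0; last exact: h1.
by apply: h2; rewrite -y10 eq_sym.
Qed.

End SimpleIntegral.

Lemma cvge0_lt {R : realFieldType} {T : Type} {F : set_system T}
    {FF : Filter F} (u : T -> \bar R) (e : R) :
  u @ F --> 0%E -> 0 < e -> \forall t \near F, (u t < e%:E)%E.
Proof.
by move=> u0 e0; apply: (u0 [set x | (x < e%:E)%E]); apply: open_ereal_lt'; rewrite lte_fin.
Qed.

(** * The Bochner integral: measurability, uniqueness, existence *)

Section BochnerIntegral.
Context {d : measure_display} {T : measurableType d} {R : realType}.
Context {mu : {measure set T -> \bar R}}.

Section Normed.
Context {X : normedModType R[i]}.

(** The norm of the difference is a pointwise limit of finite-valued real functions, so no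
    sigma-algebra on [X] enters. *)
Lemma simple_limit_measurableB (F F' : T -> X) (s s' : nat -> T -> X) :
  (forall n, bochner_simple mu (s n)) -> (forall n, bochner_simple mu (s' n)) ->
  (forall t, s n t @[n --> \oo] --> F t) ->
  (forall t, s' n t @[n --> \oo] --> F' t) ->
  measurable_fun setT (fun x => normR (F x - F' x)).
Proof.
move=> bs bs' sF sF'.
apply: (@measurable_fun_cvg _ _ _ _ (fun n x => normR (s n x - s' n x))).
  by move=> n; exact: bochner_simple_measurableB.
by move=> x _; apply: cvg_normR; exact: cvgB.
Qed.

Lemma bochner_simple_integral (s : T -> X) : bochner_simple mu s ->
  is_bochner_integral mu s (simple_integral mu s).
Proof.
move=> bs; exists (fun=> s); split => //; [by move=> t; exact: cvg_cst| |exact: cvg_cst].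
under eq_fun do (under eq_integral do rewrite subrr normR0; rewrite integral0).
exact: cvg_cst.
Qed.

Lemma bochner_measurableB (F F' : T -> X) (v v' : X) :
  is_bochner_integral mu F v -> is_bochner_integral mu F' v' ->
  measurable_fun setT (fun x => normR (F x - F' x)).
Proof.
by move=> [s [bs sF _ _]] [s' [bs' sF' _ _]]; exact: (simple_limit_measurableB bs bs').
Qed.

(** Limit of the inequality for simple functions, by |s_n - s'_n| <= |F - s_n| + |F' - s'_n| + |F -
    F'|. It serves both for uniqueness of the integral and for error estimates. *)
Lemma le_bochnerB (F F' : T -> X) (v v' : X) :
  is_bochner_integral mu F v -> is_bochner_integral mu F' v' ->
  ((normR (v - v'))%:E <= \int[mu]_x (normR (F x - F' x))%:E)%E.
Proof.
move=> Fv Fv'; have mFF := bochner_measurableB Fv Fv'.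
have [s [bs sF Fs sv]] := Fv; have [s' [bs' sF' Fs' sv']] := Fv'.
have mFs n := bochner_measurableB Fv (bochner_simple_integral (bs n)).
have mFs' n := bochner_measurableB Fv' (bochner_simple_integral (bs' n)).
set L := (\int[mu]_x _)%E.
have lhs : (normR (simple_integral mu (s n) - simple_integral mu (s' n)))%:E
    @[n --> \oo] --> (normR (v - v'))%:E.
  by apply: cvg_EFin; [near=> n|apply: cvg_normR; exact: cvgB].
have [->|Lfin] := eqVneq L +oo%E; first exact: leey.
have rhs : (\int[mu]_x (normR (F x - s n x))%:E + \int[mu]_x (normR (F' x - s' n x))%:E + L)%E
    @[n --> \oo] --> (0 + 0 + L)%E.
  by apply: cvgeD; [rewrite add0e fin_num_adde_defr|apply: cvgeD|exact: cvg_cst].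
rewrite !add0e in rhs.
rewrite -(cvg_lim _ lhs)// -(cvg_lim _ rhs)//.
apply: lee_lim; [by apply/cvg_ex; eexists; exact: lhs|by apply/cvg_ex; eexists; exact: rhs|].
apply: nearW => n; apply: le_trans (le_simple_integralB (bs n) (bs' n)) _.
rewrite /L -!ge0_integralD//; try by move=> *; rewrite ?lee_fin ?addr_ge0 ?normR_ge0.
- apply: ge0_le_integral => //.
  + by move=> x _; rewrite lee_fin normR_ge0.
  + by apply/measurable_EFinP; exact: bochner_simple_measurableB.
  + by apply: emeasurable_funD; [apply: emeasurable_funD|]; exact/measurable_EFinP.
  + move=> x _; rewrite -!EFinD lee_fin.
    rewrite (le_trans (normR_triangle _ _ (F x)))// normR_distC -addrA lerD2l.
    by rewrite (le_trans (normR_triangle _ _ (F' x)))// addrC.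
- by apply: emeasurable_funD; exact/measurable_EFinP.
- exact/measurable_EFinP.
- exact/measurable_EFinP.
- exact/measurable_EFinP.
Unshelve. all: by end_near.
Qed.

(** [xget] picks some integral of [F]; the estimate above with [F' = F] shows that there is only
    one. *)
Lemma bochner_integralP (F : T -> X) (v : X) :
  is_bochner_integral mu F v -> bochner_integral mu F = v.
Proof.
move=> Fv; have Fv' : is_bochner_integral mu F (bochner_integral mu F).
  exact: (@xgetPex _ 0 [set v | is_bochner_integral mu F v] (ex_intro _ v Fv)).
have := le_bochnerB Fv' Fv.
under eq_integral do rewrite subrr normR0.
rewrite integral0 lee_fin => h; apply/eqP; rewrite -subr_eq0 -normR_eq0.
by rewrite eq_le h normR_ge0.
Qed.

Lemma is_bochner_integralZ (c : R[i]) (F : T -> X) (v : X) :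
  is_bochner_integral mu F v ->
  is_bochner_integral mu (fun x => c *: F x) (c *: v).
Proof.
move=> Fv; have [s [bs sF Fs sv]] := Fv.
exists (fun n x => c *: s n x); split.
- by move=> n; have [] := simple_integralZ c (bs n).
- by move=> t; apply: cvgZr.
- have -> : (fun n => (\int[mu]_t (normR (c *: F t - c *: s n t))%:E)%E) =
      (fun n => ((normR c)%:E * \int[mu]_t (normR (F t - s n t))%:E)%E).
    apply/funext => n; rewrite -ge0_integralZl//.
    + by apply: eq_integral => x _; rewrite -scalerBr normRZ EFinM.
    + apply/measurable_EFinP.
      exact: (bochner_measurableB Fv (bochner_simple_integral (bs n))).
    + by move=> x _; rewrite lee_fin normR_ge0.
    + by rewrite lee_fin normR_ge0.
  by rewrite -[X in _ --> X](mule0 (normR c)%:E); apply: cvgeZl.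
- under eq_fun do rewrite (simple_integralZ c (bs _)).2.
  exact: cvgZr.
Qed.

End Normed.

(** Since |s_m - s_n| <= |F - s_m| + |F - s_n|, the integrals of the [s n] form a Cauchy sequence,
    and [X] is complete. *)
Lemma bochner_integral_exists (X : completeNormedModType R[i]) (F : T -> X)
    (s : nat -> T -> X) :
  (forall n, bochner_simple mu (s n)) ->
  (forall t, s n t @[n --> \oo] --> F t) ->
  (\int[mu]_t (normR (F t - s n t))%:E)%E @[n --> \oo] --> 0%E ->
  exists v, is_bochner_integral mu F v.
Proof.
move=> bs sF Fs.
suff /cvg_ex[v sv] : cvg ((fun n => simple_integral mu (s n)) @ \oo).
  by exists v, s; split.
apply: normR_cauchy_cvg => e e0.
have [N _ hN] := cvge0_lt Fs (divr_gt0 e0 (ltr0n _ 2)).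
exists N => m n Nm Nn.
have mFs k : measurable_fun setT (fun t => (normR (F t - s k t))%:E).
  apply/measurable_EFinP.
  by apply: (simple_limit_measurableB bs (fun=> bs k) sF) => t; exact: cvg_cst.
rewrite -lee_fin (le_trans (le_simple_integralB (bs m) (bs n)))//.
rewrite [e]splitr EFinD (le_trans _ (leeD (ltW (hN m Nm)) (ltW (hN n Nn))))//.
rewrite -ge0_integralD//; try by move=> *; rewrite lee_fin normR_ge0.
apply: ge0_le_integral => //.
- by move=> x _; rewrite lee_fin normR_ge0.
- by apply/measurable_EFinP; exact: bochner_simple_measurableB.
- exact: emeasurable_funD.
- move=> x _; rewrite -EFinD lee_fin (le_trans (normR_triangle _ _ (F x)))//.
  by rewrite normR_distC.
Qed.
End BochnerIntegral.

(** * Approximation of measurable functions by finite-valued ones *)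

Section Approximation.
Context {d : measure_display} {T : measurableType d} {R : realType}.

Lemma nonneg_finite_map_approx (h : T -> R) :
  measurable_fun setT h -> (forall x, 0 <= h x) ->
  exists r : nat -> T -> R,
    [/\ forall n, finite_map (r n), forall n x, 0 <= r n x <= h x
      & forall x, r n x @[n --> \oo] --> h x].
Proof.
move=> mh h0; have mE : measurable_fun setT (EFin \o h) by exact/measurable_EFinP.
pose r n : T -> R := nnsfun_approx measurableT mE n.
have rh x : r n x @[n --> \oo] --> h x.
  have h0' y : setT y -> (0 <= (EFin \o h) y)%E by rewrite /= lee_fin.
  exact: (fine_cvg (cvg_nnsfun_approx measurableT mE h0' (x := x) I)).
exists r; split=> //.
move=> n x; apply/andP; split; first exact: fun_ge0.
rewrite -(cvg_lim _ (rh x))//; apply: nondecreasing_cvgn_le.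
  by move=> m k mk; have /lefP := nd_nnsfun_approx measurableT mE mk; exact.
by apply/cvg_ex; eexists; exact: rh.
Qed.

Lemma finite_map_approx (h : T -> R) : measurable_fun setT h ->
  exists r : nat -> T -> R,
    [/\ forall n, finite_map (r n), forall n x, `|r n x| <= `|h x|
      & forall x, r n x @[n --> \oo] --> h x].
Proof.
move=> mh.
have [|p [fp hp cp]] := @nonneg_finite_map_approx (h^\+) (measurable_funrpos mh).
  by move=> x; exact: funrpos_ge0.
have [|q [fq hq cq]] := @nonneg_finite_map_approx (h^\-) (measurable_funrneg mh).
  by move=> x; exact: funrneg_ge0.
exists (fun n x => p n x - q n x); split.
- move=> n; exact: (finite_map_comp (fun z => z.1 - z.2) (finite_map_pair (fp n) (fq n))).
- move=> n x; have -> : `|h x| = h^\+ x + h^\- x.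
    by have /(congr1 (@^~ x)) := funrposDneg h.
  have /andP[p0 ph] := hp n x; have /andP[q0 qh] := hq n x.
  by rewrite (le_trans (ler_normB _ _))// !ger0_norm// lerD.
- move=> x; have -> : h x = h^\+ x - h^\- x.
    by have /(congr1 (@^~ x)) := funrposBneg h.
  exact: cvgB.
Qed.

(** Real and imaginary parts are approximated separately, each without increasing its absolute
    value; this costs the factor 2. *)
Lemma complex_finite_map_approx (f : T -> R[i]) :
  measurable_fun setT (fun x => complex.Re (f x)) ->
  measurable_fun setT (fun x => complex.Im (f x)) ->
  exists a : nat -> T -> R[i],
    [/\ forall n, finite_map (a n), forall n x, normR (a n x) <= 2 * normR (f x)
      & forall x, normR (a n x - f x) @[n --> \oo] --> (0 : R)].
Proof.
move=> /finite_map_approx[p [fp hp cp]] /finite_map_approx[q [fq hq cq]].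
exists (fun n x => p n x +i* q n x); split.
- by move=> n; exact: (finite_map_comp (fun z => z.1 +i* z.2) (finite_map_pair (fp n) (fq n))).
- move=> n x; rewrite (le_trans (normR_ReIm _))//= mulr2n mulrDl mul1r.
  by rewrite lerD// (le_trans (hp n x), le_trans (hq n x))// ?normR_Re ?normR_Im.
- move=> x.
  apply: (@squeeze_cvgr _ _ _ _ (fun=> 0)
      (fun n => `|p n x - complex.Re (f x)| + `|q n x - complex.Im (f x)|)).
  + apply: nearW => n; rewrite normR_ge0/= (le_trans (normR_ReIm _))//.
    by case: (f x).
  + exact: cvg_cst.
  + rewrite -[X in _ --> X](addr0 (0 : R)); apply: cvgD.
    * rewrite -(normr0 R) -(subrr (complex.Re (f x))).
      by apply: cvg_norm; apply: cvgB => //; exact: cvg_cst.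
    * rewrite -(normr0 R) -(subrr (complex.Im (f x))).
      by apply: cvg_norm; apply: cvgB => //; exact: cvg_cst.
Qed.

End Approximation.

(** * Topology of the group *)

(* compact_cover is stated for pointed spaces only. *)
HB.instance Definition _ (G : topologicalZmodType) := Topological.on (carrier G).

Section Group.
Context {G : topologicalZmodType}.

Lemma compactU (A B : set G) : compact A -> compact B -> compact (A `|` B).
Proof.
move=> cA cB; have := @bigsetU_compact G _ id [:: A; B] (fun C => `[< compact C >]).
rewrite !big_cons big_nil /= (asboolT cA) (asboolT cB) setU0.
by apply=> C /asboolP.
Qed.

Lemma compactB (A B : set G) : compact A -> compact B ->
  compact [set x.1 - x.2 | x in A `*` B].
Proof.
move=> cA cB; apply: continuous_compact; last exact: compact_setX.
by apply: continuous_subspaceT; exact: sub_continuous.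
Qed.

Lemma continuous_subr (x : G) : continuous (fun y : G => y - x).
Proof.
move=> y; apply: (@cvg_comp _ _ _ (fun y => (y, x)) (fun z : G * G => z.1 - z.2) _ (nbhs (y, x))).
  by apply: cvg_pair => /=; [exact: cvg_id|exact: cvg_cst].
exact: (@sub_continuous G (y, x)).
Qed.

Lemma open_borel (A : set G) : open A -> measurable (A : set (borel G)).
Proof. by move=> oA; exact: sub_sigma_algebra. Qed.

Lemma compact_borel (A : set G) : hausdorff_space G -> compact A ->
  measurable (A : set (borel G)).
Proof.
move=> hG cA; rewrite -(setCK (A : set (borel G))); apply: measurableC.
by apply: open_borel; apply: closed_openC; exact: compact_closed hG cA.
Qed.

Lemma continuous_borel (R : realType) (g : G -> R) : continuous g ->
  measurable_fun setT (g : borel G -> R).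
Proof.
move=> cg; apply: (measurability _ (RGenOInfty.measurableE R)) => _ [_ [a ->] <-].
rewrite setTI; apply: open_borel; apply: open_comp => [x _|]; first exact: cg.
exact: interval_open.
Qed.

Lemma sigma_compact : compactly_generated G ->
  exists K : nat -> set G,
    [/\ forall n, compact (K n), forall n, K n `<=` K n.+1
      & forall x, exists n, K n x].
Proof.
move=> [K0 cK0 gK0].
(* Repeated differences of the compact generating set, enlarged by 0 so that the sequence increases;
   the union is a subgroup that contains the generators. *)
pose K := fix K n := if n is n'.+1 then [set x.1 - x.2 | x in K n' `*` K n']
                     else K0 `|` [set 0].
have K00 n : K n 0.
  by elim: n => [|n ih]; [right|exists (0, 0) => //=; rewrite subr0].
have KS n : K n `<=` K n.+1.
  by move=> x Kx; exists (x, 0) => /=; [split|rewrite subr0].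
exists K; split => //.
  by elim=> [|n ih]; [apply: compactU => //; exact: compact_set1|exact: compactB].
have Kle m n : (m <= n)%N -> K m `<=` K n.
  move=> /subnK <-; elim: (n - m)%N => [//|k ih]; exact: subset_trans (KS _).
move=> x; have : [set: G] x by [].
rewrite -gK0; apply: (_ : smallest (@is_subgroup G) K0 `<=` [set x | exists n, K n x]).
apply: smallest_sub; last by move=> y K0y; exists 0%N; left.
split; first by exists 0%N.
move=> y z [m Ky] [n Kz]; exists (maxn m n).+1; exists (y, z) => //=; split => /=.
  exact: (Kle m) (leq_maxl _ _) _ Ky.
exact: (Kle n) (leq_maxr _ _) _ Kz.
Qed.

(** Finitely many translates of the interior of [V] cover [K], and [p] sends a point to the centre
    of a translate that contains it. Building [p] along the list of centres keeps its fibres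
    measurable; off all the translates it is 0. *)
Lemma finite_net (K V : set G) : compact K -> nbhs (0 : G) V ->
  exists p : borel G -> G, finite_map p /\ forall x, K x -> V (x - p x).
Proof.
move=> cK V0; have := cK; rewrite (@compact_cover (carrier G)).
move=> /(_ (carrier G) setT (fun x => [set y : G | V° (y - x)])) [x _|x Kx|D _ KD].
- apply: open_comp; last exact: open_interior.
  by move=> y _; exact: continuous_subr.
- exists x => //=; rewrite subrr; exact: nbhs_singleton (nbhs_interior V0).
- suff [p [fp hp]] : exists p : borel G -> G, finite_map p /\
      forall x, (exists2 z, z \in finmap.enum_fset D & V° (x - z)) -> V (x - p x).
    exists p; split => // x Kx; apply: hp; have [z Dz Vz] := KD _ Kx.
    by exists z.
  elim: (finmap.enum_fset D) => [|z s [p [fp hp]]].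
    by exists (cst 0); split; [exact: finite_map_cst|move=> x []].
  pose A : set (borel G) := [set y : G | V° (y - z)].
  have mA : measurable A.
    apply: open_borel; apply: open_comp; last exact: open_interior.
    by move=> y _; exact: continuous_subr.
  exists (fun x => if `[< A x >] then z else p x); split.
    exact: finite_map_if mA (finite_map_cst z) fp.
  move=> x [y]; case: asboolP => [Ax _ _|Ax]; first exact: interior_subset.
  by rewrite inE => /orP[/eqP -> //|ys Vy]; apply: hp; exists y.
Qed.

End Group.

(** * Approximation of the convolution by finite sums of translates *)

Section RintegralFiniteMap.
Context {d : measure_display} {T : measurableType d} {R : realType}.
Variable mu : {measure set T -> \bar R}.

Lemma Rintegral_finite_map (Y : choiceType) (q : T -> Y) (u : Y -> R) :
  finite_map q -> (forall y, u y != 0 -> (mu (q @^-1` [set y]) < +oo)%E) ->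
  \int[mu]_x u (q x) = \sum_(y \in range q) (fine (mu (q @^-1` [set y])) * u y).
Proof.
move=> fq uf; have [fr mq] := fq.
(* This is applied to the positive and the negative part of [u]. They vanish where [u] does, so the
   fibres that count have finite measure. *)
have key (v : Y -> R) : (forall y, 0 <= v y) -> (forall y, v y != 0 -> u y != 0) ->
    (\int[mu]_x (v (q x))%:E =
     (\sum_(y <- fset_set (range q)) (fine (mu (q @^-1` [set y])) * v y))%:E)%E.
  move=> v0 vu; rewrite (ge0_integral_finite_map mu fq v0) fsbig_finite//.
  rewrite -sumEFin; apply: eq_bigr => y _.
  have [->|vy] := eqVneq (v y) 0; first by rewrite mulr0 mul0e.
  by rewrite EFinM muleC fineK// ge0_fin_numE ?measure_ge0//; exact/uf/vu.
rewrite /Rintegral integralE fsbig_finite//.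
under eq_integral do rewrite funeposE -EFin_max.
under [X in (_ - X)%E]eq_integral do rewrite funenegE -EFinN -EFin_max.
rewrite (key (fun y => Num.max (u y) 0)); last 2 first.
- by move=> y; rewrite le_max lexx orbT.
- by move=> y; apply: contraNneq => ->; rewrite maxxx.
rewrite (key (fun y => Num.max (- u y) 0)); last 2 first.
- by move=> y; rewrite le_max lexx orbT.
- by move=> y; apply: contraNneq => ->; rewrite oppr0 maxxx.
rewrite -EFinB /= -sumrB; apply: eq_bigr => y _; rewrite -mulrBr; congr (_ * _).
have [u0|u0] := boolP (0 <= u y).
  by rewrite max_l// max_r ?subr0// oppr_le0.
move: u0; rewrite -ltNge => /ltW u0.
by rewrite max_r// max_l ?oppr_ge0// sub0r opprK.
Qed.

End RintegralFiniteMap.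

(** * Weights and the weighted sup norm *)

Section Weight.
Context {R : realType} {G : topologicalZmodType} {w : G -> R}.
Hypothesis ww : is_weight w.

Lemma weight_gt0 t : 0 < w t.
Proof. exact: lt_le_trans ltr01 (weight_ge1 ww t). Qed.

Lemma weight_subB s t : w (s - t) <= w s * w t.
Proof. by rewrite -(weight_sym ww t) weight_submul. Qed.

Context {X : normedModType R[i]}.

Lemma le_wsup_norm (phi : G -> X) (t : G) (M : R) :
  (wsup_norm w phi <= M%:E)%E -> normR (phi t) <= M * w t.
Proof.
move=> h; rewrite -ler_pdivrMr ?weight_gt0// -lee_fin; apply: le_trans h.
by apply: ereal_sup_ubound; exists t.
Qed.

Lemma BC_wP (phi : G -> X) : BC_w w phi ->
  exists2 M : R, 0 <= M & forall t, normR (phi t) <= M * w t.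
Proof.
move=> [_ h].
have h0 : (0 <= wsup_norm w phi)%E.
  apply: (@le_trans _ _ (normR (phi 0) / w 0)%:E).
    by rewrite lee_fin divr_ge0 ?normR_ge0// ltW// weight_gt0.
  by apply: ereal_sup_ubound; exists 0.
exists (fine (wsup_norm w phi)); first exact: fine_ge0.
by move=> t; apply: le_wsup_norm; rewrite fineK// ge0_fin_numE.
Qed.

Lemma wsup_norm_le (phi : G -> X) (M : R) :
  (forall t, normR (phi t) <= M * w t) -> (wsup_norm w phi <= M%:E)%E.
Proof.
move=> h; apply: ge_ereal_sup => _ [t _ <-].
by rewrite lee_fin ler_pdivrMr ?weight_gt0.
Qed.

Lemma BUC_wP (phi : G -> X) : BUC_w w phi -> forall e : R, 0 < e ->
  \forall h \near (0 : G), forall t, normR (phi (t + h) - phi t) <= e * w t.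
Proof.
move=> [_ h] e e0; apply: filterS (cvge0_lt h e0) => k /ltW hk t.
exact: (le_wsup_norm t hk).
Qed.

End Weight.

(** * The space [L1_w] and compactly supported simple approximants *)

Section Convolution.
Context {R : realType} {G : topologicalZmodType}.
Context {mu : {measure set (borel G) -> \bar R}} {w : G -> R}.
Hypotheses (hG : hausdorff_space G) (cgG : compactly_generated G).
Hypothesis ww : is_weight w.

Let wm : measurable_fun setT (w : borel G -> R) := continuous_borel (weight_continuous ww).

Lemma normR_measurable (f : G -> R[i]) :
  measurable_fun setT ((fun t => complex.Re (f t)) : borel G -> R) ->
  measurable_fun setT ((fun t => complex.Im (f t)) : borel G -> R) ->
  measurable_fun setT ((fun t => normR (f t)) : borel G -> R).
Proof.
move=> mRe mIm.
have -> : (fun t => normR (f t)) =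
    Num.sqrt \o (fun t => complex.Re (f t) ^+ 2 + complex.Im (f t) ^+ 2).
  by apply/funext => t; rewrite /normR normc_def.
apply: measurableT_comp.
  by apply: continuous_measurable_fun; exact: sqrt_continuous.
by apply: measurable_funD; exact: measurable_funX.
Qed.

Lemma w1_measurable (f : G -> R[i]) :
  measurable_fun setT ((fun t => complex.Re (f t)) : borel G -> R) ->
  measurable_fun setT ((fun t => complex.Im (f t)) : borel G -> R) ->
  measurable_fun setT ((fun t => (normR (f t) * w t)%:E) : borel G -> \bar R).
Proof.
by move=> ? ?; apply/measurable_EFinP; apply: measurable_funM => //; exact: normR_measurable.
Qed.

Lemma w1_ge0 (z : R[i]) t : (0 <= (normR z * w t)%:E)%E.
Proof. by rewrite lee_fin mulr_ge0 ?normR_ge0// ltW// (weight_gt0 ww). Qed.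

Lemma L1_wB (f g : G -> R[i]) : L1_w mu w f -> L1_w mu w g ->
  L1_w mu w (fun t => f t - g t).
Proof.
move=> [f1 f2 f3] [g1 g2 g3].
have fg1 : measurable_fun setT ((fun t => complex.Re (f t - g t)) : borel G -> R).
  have -> : (fun t => complex.Re (f t - g t)) =
      (fun t => complex.Re (f t) - complex.Re (g t)).
    by apply/funext => t; case: (f t); case: (g t).
  exact: measurable_funB.
have fg2 : measurable_fun setT ((fun t => complex.Im (f t - g t)) : borel G -> R).
  have -> : (fun t => complex.Im (f t - g t)) =
      (fun t => complex.Im (f t) - complex.Im (g t)).
    by apply/funext => t; case: (f t); case: (g t).
  exact: measurable_funB.
have [[mf mg] mfg] := (w1_measurable f1 f2, w1_measurable g1 g2, w1_measurable fg1 fg2).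
split; [exact: fg1|exact: fg2|].
apply: (@le_lt_trans _ _ (w1_norm mu w f + w1_norm mu w g)%E).
  rewrite /w1_norm -ge0_integralD//; try by move=> t _; exact: w1_ge0.
  apply: ge0_le_integral => //; [by move=> t _; exact: w1_ge0|exact: emeasurable_funD|].
  move=> t _; rewrite -EFinD lee_fin -mulrDl ler_wpM2r ?normRB//.
  exact/ltW/(weight_gt0 ww).
by rewrite lte_add_pinfty.
Qed.

Lemma L1_w_le (f g : G -> R[i]) (C : R) : L1_w mu w f ->
  measurable_fun setT ((fun t => complex.Re (g t)) : borel G -> R) ->
  measurable_fun setT ((fun t => complex.Im (g t)) : borel G -> R) ->
  (forall x, normR (g x) <= C * normR (f x)) -> L1_w mu w g.
Proof.
move=> [f1 f2 f3] g1 g2 gf; split => //.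
apply: (@le_lt_trans _ _ (`|C|%:E * w1_norm mu w f)%E).
  rewrite /w1_norm -ge0_integralZl//; last by move=> t _; exact: w1_ge0.
  - apply: ge0_le_integral => //.
    + by move=> t _; exact: w1_ge0.
    + exact: w1_measurable.
    + by apply: measurable_funeM; exact: w1_measurable.
    + move=> t _; rewrite -EFinM lee_fin mulrA ler_wpM2r ?(ltW (weight_gt0 ww _))//.
      by rewrite (le_trans (gf t))// ler_wpM2r ?normR_ge0// ler_norm.
  - exact: w1_measurable.
by rewrite lte_mul_pinfty// lee_fin.
Qed.

(** Since [w >= 1], the weighted norm dominates the unweighted one. In the applications [u] is the
    real or the imaginary part. *)
Lemma L1_w_integrable (f : G -> R[i]) (u : R[i] -> R) : L1_w mu w f ->
  (forall z, `|u z| <= normR z) ->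
  measurable_fun setT ((fun t => u (f t)) : borel G -> R) ->
  mu.-integrable setT ((fun t => (u (f t))%:E) : borel G -> \bar R).
Proof.
move=> [f1 f2 f3] hu mu1; apply/integrableP; split; first exact/measurable_EFinP.
apply: le_lt_trans f3; apply: ge0_le_integral => //.
- by apply/measurable_EFinP; exact: measurableT_comp.
- exact: w1_measurable.
- move=> t _; rewrite /= lee_fin (le_trans (hu _))// ler_peMr ?normR_ge0//.
  exact: weight_ge1 ww t.
Qed.

(** Real and imaginary parts are bounded separately, each by the weighted norm; hence the factor
    2. *)
Lemma complex_integralB (f g : G -> R[i]) : L1_w mu w f -> L1_w mu w g ->
  ((normR (complex_integral mu f - complex_integral mu g))%:E
     <= 2%:E * w1_norm mu w (fun t => f t - g t)%R)%E.
Proof.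
move=> Lf Lg; have [[f1 f2 f3] [g1 g2 g3]] := (Lf, Lg).
have [h1 h2 h3] := L1_wB Lf Lg; set h := (fun t => f t - g t) in h1 h2 h3 *.
have part (u : R[i] -> R) : (forall z, `|u z| <= normR z) ->
    (forall x y, u (x - y) = u x - u y) ->
    measurable_fun setT ((fun t => u (f t)) : borel G -> R) ->
    measurable_fun setT ((fun t => u (g t)) : borel G -> R) ->
    ((`| \int[mu]_t u (f t) - \int[mu]_t u (g t)|)%:E <= w1_norm mu w h)%E.
  move=> hu uB mf mg.
  have [If Ig] := (L1_w_integrable Lf hu mf, L1_w_integrable Lg hu mg).
  have muh : measurable_fun setT ((fun t => u (f t) - u (g t)) : borel G -> R).
    exact: measurable_funB.
  rewrite -RintegralB// -abse_EFin /Rintegral fineK; last first.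
    by apply: integrable_fin_num => //; exact: integrableB If Ig.
  apply: le_trans (le_abse_integral _ _ _) _ => //; first exact/measurable_EFinP.
  apply: ge0_le_integral => //.
  - by apply/measurable_EFinP; exact: measurableT_comp.
  - exact: w1_measurable.
  - move=> t _; rewrite /= lee_fin -uB (le_trans (hu _))// ler_peMr ?normR_ge0//.
    exact: weight_ge1 ww t.
have re := part (@complex.Re R) (@normR_Re R) (fun x y => raddfB (@complex.Re R) x y) f1 g1.
have im := part (@complex.Im R) (@normR_Im R) (fun x y => raddfB (@complex.Im R) x y) f2 g2.
rewrite mule_natl mule2n; apply: le_trans (leeD re im).
by rewrite -EFinD lee_fin; exact: normR_ReIm.
Qed.

(** Chebyshev's inequality: on [A] the integrand |f| w is at least |c| / 2. *)
Lemma L1_w_level (f a : G -> R[i]) (c : R[i]) (A : set (borel G)) : L1_w mu w f ->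
  (forall x, normR (a x) <= 2 * normR (f x)) -> measurable A ->
  c != 0 -> (forall x, A x -> a x = c) -> (mu A < +oo)%E.
Proof.
move=> [f1 f2 f3] af mA c0 Ac.
have c2 : 0 < normR c / 2.
  by rewrite divr_gt0// lt_neqAle normR_ge0 eq_sym normR_eq0 c0.
have : ((normR c / 2)%:E * mu A < +oo)%E.
  apply: le_lt_trans f3; rewrite -integral_cst//.
  apply: (@le_trans _ _ (\int[mu]_(x in A) (normR (f x) * w x)%:E)%E).
    apply: ge0_le_integral => //; [by move=> *; rewrite lee_fin ltW| |].
      by apply: measurable_funTS; exact: w1_measurable.
    move=> x Ax; rewrite lee_fin ler_pdivrMr// -(Ac x Ax) mulrAC.
    rewrite (le_trans (af x))// mulrC ler_peMr ?mulr_ge0 ?normR_ge0//.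
    exact: weight_ge1 ww x.
  apply: ge0_subset_integral => //; first exact: w1_measurable.
  by move=> t _; exact: w1_ge0.
have [->|] := eqVneq (mu A) +oo%E; last by rewrite -ltey.
by rewrite gt0_muley// lte_fin.
Qed.

(** Finite-valued approximants of [f] are cut off along an exhaustion of the group by compact sets,
    and dominated convergence gives the last limit. The compact supports are what makes finite nets
    available later. *)
Lemma L1_w_approx (f : G -> R[i]) : L1_w mu w f ->
  exists a : nat -> G -> R[i],
    [/\ forall n, finite_map (a n : borel G -> R[i]) /\ L1_w mu w (a n),
        forall n x, normR (a n x) <= 2 * normR (f x),
        forall n, exists2 K : set G, compact K & forall x, a n x != 0 -> K x,
        forall x, normR (a n x - f x) @[n --> \oo] --> (0 : R)
      & w1_norm mu w (fun x => a n x - f x) @[n --> \oo] --> 0%E].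
Proof.
move=> Lf; have [f1 f2 f3] := Lf.
have [b [fb hb cb]] := complex_finite_map_approx f1 f2.
have [K [cK KS KT]] := sigma_compact cgG.
pose a n x := if `[< K n x >] then b n x else 0.
have fa n : finite_map (a n : borel G -> R[i]).
  by apply: finite_map_if; [exact: compact_borel|exact: fb|exact: finite_map_cst].
have ha n x : normR (a n x) <= 2 * normR (f x).
  by rewrite /a; case: asboolP => _ //; rewrite normR0 mulr_ge0 ?normR_ge0.
have ca x : normR (a n x - f x) @[n --> \oo] --> (0 : R).
  apply: cvg_trans (cb x); apply: near_eq_cvg.
  have [N KN] := KT x; exists N => // n /= Nn.
  suff Kn : K n x by rewrite /a asboolT.
  by rewrite -(subnK Nn); elim: (n - N)%N => [|k ih] //; exact: KS.
have La n : L1_w mu w (a n).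
  apply: (L1_w_le (C := 2) Lf) => //; apply: finite_map_fun.
    exact: (finite_map_comp (@complex.Re R) (fa n)).
  exact: (finite_map_comp (@complex.Im R) (fa n)).
exists a; split => //.
  move=> n; exists (K n) => // x; apply: contraNP => nK.
  by rewrite /a asboolF.
(* The dominating function: |a_n - f| <= 2 |f| + |f|. *)
have wf_int : mu.-integrable setT ((fun x => (3 * (normR (f x) * w x))%:E) : borel G -> \bar R).
  under eq_fun do rewrite EFinM.
  apply: integrableZl => //; apply/integrableP; split; first exact: w1_measurable.
  apply: le_lt_trans f3; apply: ge0_le_integral => //.
  - by apply: measurableT_comp => //; exact: w1_measurable.
  - exact: w1_measurable.
  - by move=> t _; rewrite gee0_abs//; exact: w1_ge0.
have mB n := L1_wB (La n) Lf.
have -> : 0%E = (\int[mu]_x (cst 0 : borel G -> \bar R) x)%E by rewrite integral0.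
rewrite /w1_norm.
apply: (@dominated_cvg _ _ _ mu setT measurableT
  (fun n x => (normR (a n x - f x) * w x)%:E) (cst 0%E)
  (fun x => (3 * (normR (f x) * w x))%:E)) => //.
- by move=> n; have [? ? _] := mB n; exact: w1_measurable.
- move=> x _; apply: cvg_EFin; first exact: nearW.
  by rewrite -[X in _ --> X](mul0r (w x)); apply: cvgMl; exact: ca.
- move=> n x _; rewrite gee0_abs; last exact: w1_ge0.
  rewrite lee_fin mulrA ler_wpM2r ?(ltW (weight_gt0 ww _))//.
  rewrite (le_trans (normRB _ _))// (_ : 3 = 2 + 1); last by rewrite -natr1.
  by rewrite mulrDl mul1r lerD.
Qed.

End Convolution.

(** * Step functions for the convolution integrand *)

Section ConvolutionApprox.
Context {R : realType} {G : topologicalZmodType}.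
Context {mu : {measure set (borel G) -> \bar R}} {w : G -> R}.
Hypotheses (hG : hausdorff_space G) (cgG : compactly_generated G).
Hypothesis ww : is_weight w.
Context {X : completeNormedModType R[i]}.
Variables (phi : G -> X) (f : G -> R[i]).
Hypotheses (phiB : BUC_w w phi) (Lf : L1_w mu w f).

(** The integrand [f x *: phi (y - x)] with [f x] and [x] replaced by the components of [q x]. As
    [q] does not involve [y], one [q] can serve all [y]. *)
Let step (q : G -> R[i] * G) (y x : G) : X := (q x).1 *: phi (y - (q x).2).

Lemma bochner_simple_step (q : G -> R[i] * G) (y : G) :
  finite_map (q : borel G -> _) ->
  (forall c, c.1 != 0 -> (mu (q @^-1` [set c]) < +oo)%E) ->
  bochner_simple mu (step q y : borel G -> X) /\
  simple_integral mu (step q y : borel G -> X) =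
    \sum_(c \in range q) ((fine (mu (q @^-1` [set c])))%:C * c.1) *: phi (y - c.2).
Proof.
move=> fq hq.
have h c : c.1 *: phi (y - c.2) != 0 -> (mu (q @^-1` [set c]) < +oo)%E.
  by move=> cn; apply: hq; apply: contraNneq cn => ->; rewrite scale0r.
split; first exact: (bochner_simple_comp fq h).
rewrite (simple_integral_comp fq h).
by apply: eq_fsbigr => c _; rewrite scalerA.
Qed.

(* q n = (a, p) where a is a simple function approximating f and p sends each x
   in a large compact set to a nearby point of a finite net. *)
Lemma convolution_steps : exists q : nat -> G -> R[i] * G,
  [/\ forall n, finite_map (q n : borel G -> _) /\
        (forall c, c.1 != 0 -> (mu (q n @^-1` [set c]) < +oo)%E),
      forall n, L1_w mu w (fun x => (q n x).1),
      w1_norm mu w (fun x => (q n x).1 - f x) @[n --> \oo] --> 0%E,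
      forall y : G, is_bochner_integral mu ((fun x : G => f x *: phi (y - x)) : borel G -> X)
        (convolution mu phi f y)
    & exists2 eps : nat -> \bar R, eps @ \oo --> 0%E & forall n y,
        (\int[mu]_x (normR (f x *: phi (y - x) - step (q n) y x))%:E
          <= (w y)%:E * eps n)%E].
Proof.
have [f1 f2 f3] := Lf.
have [a [faL ha aK ca cw]] := L1_w_approx hG cgG ww Lf.
have fa n : finite_map (a n : borel G -> _) := (faL n).1.
have La n : L1_w mu w (a n) := (faL n).2.
have [M M0 hM] := BC_wP ww phiB.1.
(* The net for the neighbourhood of 0 that w-uniform continuity attaches to the tolerance 1/(n+1);
   the estimate at [t = y - x] holds for all [y] at once. *)
have /choice[p hp] n : exists p : G -> G, finite_map (p : borel G -> G) /\
    forall x, a n x != 0 ->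
      forall y, normR (phi (y - p x) - phi (y - x)) <= n.+1%:R^-1 * w (y - x).
  have [K cK aKn] := aK n.
  have V0 : nbhs (0 : G) [set h | forall t, normR (phi (t + h) - phi t) <= n.+1%:R^-1 * w t].
    exact: (BUC_wP ww phiB).
  have [p [fp Vp]] := finite_net cK V0.
  exists p; split => // x /aKn/Vp/= h y.
  by have := h (y - x); rewrite addrA subrK.
pose q n x := (a n x, p n x).
have fq n : finite_map (q n : borel G -> _) by apply: finite_map_pair => //; exact: (hp n).1.
have mq n c : c.1 != 0 -> (mu (q n @^-1` [set c]) < +oo)%E.
  move=> c0; apply: (L1_w_level ww Lf (ha n) _ c0); first by have [_] := fq n; exact.
  by move=> x /= <-.
have bs n y := (bochner_simple_step y (fq n) (mq n)).1.
have psi_bound x y : normR (phi (y - x)) <= M * (w y * w x).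
  by rewrite (le_trans (hM _))// ler_wpM2l// (weight_subB ww).
(* The error splits into (f - a) phi(y - x) and a (phi(y - x) - phi(y - p x)); w(y - x) <= w(y) w(x)
   makes the dependence on [y] a mere factor [w y]. *)
have bound n y x : normR (f x *: phi (y - x) - step (q n) y x) <=
    w y * (M * (normR (a n x - f x) * w x) + 2 / n.+1%:R * (normR (f x) * w x)).
  rewrite /step /q /= (le_trans (normR_triangle _ _ (a n x *: phi (y - x))))// mulrDr lerD//.
    rewrite -scalerBl normRZ normR_distC.
    rewrite [leRHS](_ : _ = normR (a n x - f x) * (M * (w y * w x))); last by ring.
    by rewrite ler_wpM2l ?normR_ge0.
  rewrite -scalerBr normRZ normR_distC.
  (* Where [a n x] vanishes, [p n x] is not controlled, but the term is 0. *)
  have [->|a0] := eqVneq (a n x) 0.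
    by rewrite normR0 mul0r !mulr_ge0 ?normR_ge0 ?invr_ge0// ltW// (weight_gt0 ww).
  rewrite [leRHS](_ : _ = (2 * normR (f x)) * (n.+1%:R^-1 * (w y * w x))); last by ring.
  rewrite ler_pM ?normR_ge0//.
  by rewrite (le_trans ((hp n).2 x a0 y))// ler_wpM2l ?invr_ge0// (weight_subB ww).
have ptw y x : step (q n) y x @[n --> \oo] --> f x *: phi (y - x).
  apply/cvg_normRP.
  apply: (@squeeze_cvgr _ _ _ _ (fun=> 0) (fun n => w y * (M * (normR (a n x - f x) * w x)
     + 2 / n.+1%:R * (normR (f x) * w x)))); [|exact: cvg_cst|].
    by apply: nearW => n; rewrite normR_ge0/= normR_distC bound.
  rewrite -[X in _ --> X](mulr0 (w y)); apply: cvgMr.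
  rewrite -[X in _ --> X](addr0 (0 : R)); apply: cvgD.
    rewrite -[X in _ --> X](mulr0 M); apply: cvgMr.
    by rewrite -[X in _ --> X](mul0r (w x)); apply: cvgMl; exact: ca.
  rewrite -[X in _ --> X](mul0r (normR (f x) * w x)); apply: cvgMl.
  by rewrite -[X in _ --> X](mulr0 2); apply: cvgMr; exact: cvg_harmonic.
(* Integral over [x] of the pointwise bound without its factor [w y]. *)
pose eps n := (M%:E * w1_norm mu w (fun x => a n x - f x)%R
   + (2 / n.+1%:R)%:E * w1_norm mu w f)%E.
have eps0 : eps @ \oo --> 0%E.
  rewrite -[X in _ --> X](adde0 0%E); apply: cvgeD; first exact: fin_num_adde_defr.
    by rewrite -[X in _ --> X](mule0 M%:E); apply: cvgeZl.
  rewrite -[X in _ --> X](mul0e (w1_norm mu w f)); apply: cvgeZr.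
    rewrite ge0_fin_numE//; apply: integral_ge0 => x _; exact: w1_ge0.
  apply: cvg_EFin; first exact: nearW.
  by rewrite -[X in _ --> X](mulr0 2); apply: cvgMr; exact: cvg_harmonic.
have mstep n y : measurable_fun setT
    ((fun x => (normR (f x *: phi (y - x) - step (q n) y x))%:E) : borel G -> \bar R).
  apply/measurable_EFinP.
  apply: (simple_limit_measurableB (mu := mu) (T := borel G) (s := fun n => step (q n) y)
    (s' := fun=> step (q n) y)) => //.
  by move=> x; exact: cvg_cst.
have le_eps n y : (\int[mu]_x (normR (f x *: phi (y - x) - step (q n) y x))%:E
          <= (w y)%:E * eps n)%E.
  have [u1 u2 u3] := L1_wB ww (La n) Lf.
  have [muw mfw] := (w1_measurable ww u1 u2, w1_measurable ww f1 f2).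
  have m1 : measurable_fun setT ((fun x => (M * (normR (a n x - f x) * w x))%:E) : borel G -> \bar R).
    by under eq_fun do rewrite EFinM; exact: measurable_funeM.
  have m2 : measurable_fun setT ((fun x => (2 / n.+1%:R * (normR (f x) * w x))%:E) : borel G -> \bar R).
    by under eq_fun do rewrite EFinM; exact: measurable_funeM.
  have p1 x : (0 <= (M * (normR (a n x - f x) * w x))%:E)%E.
    by rewrite EFinM mule_ge0 ?lee_fin// -lee_fin; exact: w1_ge0.
  have p2 x : (0 <= (2 / n.+1%:R * (normR (f x) * w x))%:E)%E.
    by rewrite EFinM mule_ge0 ?lee_fin// -lee_fin; exact: w1_ge0.
  apply: (@le_trans _ _ (\int[mu]_x ((w y)%:E * ((M * (normR (a n x - f x) * w x))%:E
      + (2 / n.+1%:R * (normR (f x) * w x))%:E)))%E).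
    apply: ge0_le_integral => //.
    - by move=> x _; rewrite lee_fin normR_ge0.
    - by apply: measurable_funeM; exact: emeasurable_funD.
    - by move=> x _; rewrite -EFinD -EFinM lee_fin bound.
  rewrite ge0_integralZl//; last 3 first.
  - exact: emeasurable_funD.
  - by move=> x _; rewrite adde_ge0.
  - by rewrite lee_fin ltW// (weight_gt0 ww).
  rewrite lee_wpmul2l// ?lee_fin ?(ltW (weight_gt0 ww _))//.
  rewrite ge0_integralD// /eps leeD//.
    under eq_integral do rewrite EFinM.
    by rewrite ge0_integralZl// => x _; exact: w1_ge0.
  under eq_integral do rewrite EFinM.
  by rewrite ge0_integralZl// => x _; exact: w1_ge0.
exists q; split; [by move=> n; split; [exact: fq|exact: mq]|exact: La|exact: cw| |by exists eps].
move=> y.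
have [v vF] : exists v, is_bochner_integral mu ((fun x : G => f x *: phi (y - x)) : borel G -> X) v.
  apply: (@bochner_integral_exists _ (borel G) _ mu X _ (fun n => step (q n) y)).
  - by move=> n; exact: bs.
  - by move=> x; exact: ptw.
  - apply: (@squeeze_cvge _ _ _ _ (fun=> 0%E) _ (fun n => (w y)%:E * eps n)%E).
    + apply: nearW => n; rewrite le_eps andbT.
      by apply: integral_ge0 => x _; rewrite lee_fin normR_ge0.
    + exact: cvg_cst.
    + by rewrite -[X in _ --> X](mule0 (w y)%:E); apply: cvgeZl.
by rewrite /convolution (bochner_integralP vF).
Qed.

Lemma convolution_sum_approx (e : R) : complex_integral mu f = 0 -> 0 < e ->
  exists s : seq (R[i] * G),
    (forall y, normR (convolution mu phi f y - \sum_(c <- s) c.1 *: phi (y - c.2))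
       <= e * w y) /\ normR (\sum_(c <- s) c.1) <= e.
Proof.
move=> f0 e0; have [q [fq Lq qw bF [eps eps0 le_eps]]] := convolution_steps.
(* The half compensates for the factor 2 in [complex_integralB]. *)
have e2 : 0 < e / 2 by rewrite divr_gt0.
have [n [n1 n2]] : exists n, (eps n < e%:E)%E /\
    (w1_norm mu w (fun x => (q n x).1 - f x)%R < (e / 2)%:E)%E.
  have [N _ hN] := filterI (cvge0_lt eps0 e0) (cvge0_lt qw e2).
  by exists N; apply: (hN N) => /=.
have [fqn hq] := fq n.
(* A value (a, p) of [q n] contributes the point p with coefficient a times the measure of its
   fibre. *)
exists [seq ((fine (mu (q n @^-1` [set c])))%:C * c.1, c.2) | c <- fset_set (range (q n))].
have [fr _] := fqn; split.
  move=> y; have [bs bsE] := bochner_simple_step y fqn hq.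
  rewrite big_map /= -[X in _ - X]fsbig_finite// -bsE -lee_fin.
  apply: le_trans (le_bochnerB (bF y) (bochner_simple_integral bs)) _.
  apply: le_trans (le_eps n y) _; rewrite mulrC EFinM lee_wpmul2l ?(ltW n1)//.
  by rewrite lee_fin ltW// (weight_gt0 ww).
rewrite big_map /=.
(* The coefficients add up to the integral of the simple approximant of [f], which is close to the
   integral of [f], that is, to 0. *)
have -> : \sum_(c <- fset_set (range (q n))) (fine (mu (q n @^-1` [set c])))%:C * c.1 =
    complex_integral mu (fun x => (q n x).1).
  rewrite /complex_integral.
  have h (u : R[i] -> R) : (forall z, `|u z| <= normR z) -> forall c : R[i] * G,
      u c.1 != 0 -> (mu (q n @^-1` [set c]) < +oo)%E.
    move=> uz c uc; apply: hq; apply: contraNneq uc => c0.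
    by rewrite -normr_le0 (le_trans (uz _))// c0 normR0.
  rewrite (Rintegral_finite_map (u := fun c => complex.Re c.1) fqn (h _ (@normR_Re R))).
  rewrite (Rintegral_finite_map (u := fun c => complex.Im c.1) fqn (h _ (@normR_Im R))).
  rewrite !fsbig_finite//.
  elim/big_ind3 : _ => //.
    by move=> _ x2 x3 _ y2 y3 -> ->.
  move=> c _; case: c.1 => x y /=.
  by apply/eqP; rewrite eq_complex /= !mul0r subr0 addr0 !eqxx.
have := complex_integralB ww (Lq n) Lf; rewrite f0 subr0.
move/(fun h => le_lt_trans h (_ : (_ < e%:E)%E)) => h.
rewrite -lee_fin; apply/ltW/h.
rewrite [e](_ : _ = 2 * (e / 2)); last by rewrite mulrC divfK.
by rewrite EFinM lte_pmul2l// lte_fin.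
Qed.

End ConvolutionApprox.

(** * Folner sets *)

Section Growth.
Context {R : realType}.

Lemma bernoulli_ineq (k : nat) (e : R) : 0 <= e -> 1 + k%:R * e <= (1 + e) ^+ k.
Proof.
move=> e0; elim: k => [|k ih]; first by rewrite mul0r addr0 expr0.
rewrite exprS; apply: (@le_trans _ _ ((1 + e) * (1 + k%:R * e))).
  rewrite -natr1 -subr_ge0 [X in 0 <= X](_ : _ = k%:R * (e * e)); last by ring.
  by rewrite !mulr_ge0.
by rewrite ler_wpM2l// addr_ge0.
Qed.

Lemma exists_expr_gt_poly (m : nat) (e : R) : 0 < e ->
  exists n : nat, n.+1%:R ^+ m < (1 + e) ^+ n.
Proof.
move=> e0; have e0' : 0 < e ^+ m.+1 by rewrite exprn_gt0.
have q0 : 0 <= m.+2%:R ^+ m / e ^+ m.+1 :> R by rewrite divr_ge0// ?exprn_ge0// ltW.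
set k := (Num.bound (m.+2%:R ^+ m / e ^+ m.+1 : R)).
have kq : m.+2%:R ^+ m / e ^+ m.+1 < k%:R :> R := archi_boundP q0.
have k0 : 0 < k%:R :> R := le_lt_trans q0 kq.
(* For this n, n + 1 <= (m + 2) k and (1 + e)^n >= (k e)^(m+1) by Bernoulli; [k] was chosen so that
   k e^(m+1) > (m + 2)^m. *)
exists (m.+1 * k)%N.
apply: (@le_lt_trans _ _ ((m.+2%:R * k%:R) ^+ m)).
  apply: lerXn2r; rewrite ?nnegrE ?mulr_ge0// -natrM ler_nat.
  by rewrite ltr0n in k0; rewrite [leqRHS]mulSn -addn1 addnC leq_add2r.
apply: (@lt_le_trans _ _ ((k%:R * e) ^+ m.+1)).
  rewrite !exprMn [k%:R ^+ m.+1]exprSr -mulrA mulrC ltr_pM2l ?exprn_gt0//.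
  by rewrite -ltr_pdivrMr.
rewrite mulnC exprM; apply: lerXn2r; rewrite ?nnegrE.
- by rewrite mulr_ge0// ltW.
- by rewrite exprn_ge0// addr_ge0// ltW.
- rewrite (le_trans _ (bernoulli_ineq k (ltW e0)))// lerDr.
  exact: ler01.
Qed.

(** Otherwise every ratio exceeds 1 + e, so c n >= (1 + e)^n, which eventually beats the polynomial
    bound. *)
Lemma exists_slow_growth (c : nat -> nat) (m : nat) (e : R) :
  (0 < c 0)%N -> (forall n, (c n <= n.+1 ^ m)%N) -> 0 < e ->
  exists n, (c n.+1)%:R <= (1 + e) * (c n)%:R.
Proof.
move=> c0 cm e0; apply/not_existsP => h.
have [n] := exists_expr_gt_poly m e0; apply/negP; rewrite -leNgt.
apply: (@le_trans _ _ (c n)%:R); last by rewrite -natrX ler_nat.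
elim: n => [|n ih]; first by rewrite expr0 ler1n.
have /negP := h n; rewrite -ltNge => /ltW; apply: le_trans.
by rewrite exprS ler_wpM2l// addr_ge0// ltW.
Qed.

End Growth.

(** * Boxes, their averages, and unions of distant translates *)

Section Folner.
Context {R : realType} {G : topologicalZmodType}.

(** The points - sum_i k_i x_i with 0 <= k_i <= n, possibly with repetitions. The sign fits the
    shifts by - x_i in the convolution. *)
Fixpoint box (s : seq G) (n : nat) : seq G :=
  if s is x :: s' then [seq b - x *+ k | b <- box s' n, k <- iota 0 n.+1] else [:: 0].

Lemma size_box s n : size (box s n) = (n.+1 ^ size s)%N.
Proof. by elim: s => [//|x s ih]; rewrite size_allpairs ih size_iota expnSr. Qed.

Lemma mem_boxP x s n y :
  reflect (exists b k, [/\ b \in box s n, (k <= n)%N & y = b - x *+ k])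
    (y \in box (x :: s) n).
Proof.
apply: (iffP (@allpairsP _ _ _ _ _ _ _)) => [[[b k] [bs kn ->]]|[b [k [bs kn ->]]]].
  by exists b, k; split => //; move: kn; rewrite mem_iota.
by exists (b, k); split; rewrite ?mem_iota.
Qed.

Lemma box0 s n : 0 \in box s n.
Proof.
elim: s => [|x s ih]; first by rewrite mem_seq1.
by apply/mem_boxP; exists 0, 0%N; rewrite mulr0n subr0.
Qed.

Lemma box_sub s n : {subset box s n <= box s n.+1}.
Proof.
elim: s => [//|x s ih] _ /mem_boxP[b [k [bs kn ->]]].
by apply/mem_boxP; exists b, k; split; [exact: ih|exact: leqW|].
Qed.

Lemma box_step s n x b : x \in s -> b \in box s n -> b - x \in box s n.+1.
Proof.
elim: s b => [//|y s ih] _ + /mem_boxP[b [k [bs kn ->]]].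
rewrite inE => /orP[/eqP ->|xs]; apply/mem_boxP.
  exists b, k.+1; split => //; first exact: box_sub.
  by rewrite mulrSr opprD addrA.
by exists (b - x), k; split; [exact: ih|exact: leqW|rewrite addrAC].
Qed.

(* Boxes have polynomial growth, so some box is almost as large as the next. *)
Lemma exists_folner (s : seq G) (e : R) : 0 < e ->
  exists B B' : seq G, [/\ uniq B /\ uniq B', B != [::], {subset B <= B'},
    forall x b, x \in s -> b \in B -> b - x \in B'
    & (size B')%:R <= (1 + e) * (size B)%:R].
Proof.
move=> e0.
(* Growth is measured on distinct points; counted with repetitions there are (n+1)^|s|, which bounds
   it. *)
have [|n|n hn] := @exists_slow_growth R (fun n => size (undup (box s n))) (size s) e _ _ e0.
- by case E : undup (box0 s 0) => [|//]; rewrite -mem_undup E.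
- by rewrite (leq_trans (size_undup _))// size_box.
exists (undup (box s n)), (undup (box s n.+1)); split => //.
- by rewrite !undup_uniq.
- by case E : undup (box0 s n) => [|//]; rewrite -mem_undup E.
- by move=> b; rewrite !mem_undup; exact: box_sub.
- by move=> x b xs; rewrite !mem_undup; exact: box_step.
Qed.

Context {X : normedModType R[i]}.

Lemma normR_sum_subset (B B' : seq G) (g : G -> X) (M : R) :
  uniq B -> uniq B' -> {subset B <= B'} -> (forall t, normR (g t) <= M) ->
  normR (\sum_(t <- B') g t - \sum_(t <- B) g t) <= M * ((size B')%:R - (size B)%:R).
Proof.
move=> uB uB' BB' gM.
have pB : perm_eq B [seq t <- B' | t \in B].
  apply: uniq_perm => //; first exact: filter_uniq.
  by move=> t; rewrite mem_filter; case: (boolP (t \in B)) => //= /BB' ->.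
rewrite (bigID (mem B))/= [\sum_(t <- B) _](perm_big _ pB) big_filter addrAC subrr add0r.
apply: le_trans (normR_sum _ _ _) _.
apply: (@le_trans _ _ (\sum_(t <- B' | t \notin B) M)); first exact: ler_sum.
rewrite big_const_seq iter_addr_0 -[leLHS]mulr_natr -natrB; last exact: uniq_leq_size.
rewrite -(count_predC (mem B) B') (perm_size pB) size_filter addnC addnK.
by [].
Qed.

(** Both [B] and its translate by - x lie in [B'], which has at most e |B| further points. Comparing
    each sum with the one over [B'] costs e M |B|, twice. *)
Lemma folner_sum (s B B' : seq G) (g : G -> X) (M e : R) x :
  uniq B -> uniq B' -> {subset B <= B'} ->
  (forall x b, x \in s -> b \in B -> b - x \in B') ->
  (size B')%:R <= (1 + e) * (size B)%:R ->
  0 <= M -> (forall t, normR (g t) <= M) -> x \in s ->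
  normR (\sum_(t <- B) g (t - x) - \sum_(t <- B) g t) <= 2 * e * M * (size B)%:R.
Proof.
move=> uB uB' BB' sB' eB M0 gM xs.
rewrite -(big_map (fun t => t - x) xpredT g).
set C := [seq t - x | t <- B].
have h1 : normR (\sum_(t <- B') g t - \sum_(t <- C) g t) <= M * (e * (size B)%:R).
  apply: le_trans (normR_sum_subset _ uB' _ gM) _.
  - by rewrite map_inj_uniq//; exact: addIr.
  - by move=> _ /mapP[b bB ->]; exact: sB'.
  - by rewrite size_map ler_wpM2l// lerBlDl -{1}[(size B)%:R]mul1r -mulrDl.
have h2 : normR (\sum_(t <- B') g t - \sum_(t <- B) g t) <= M * (e * (size B)%:R).
  apply: le_trans (normR_sum_subset uB uB' BB' gM) _.
  by rewrite ler_wpM2l// lerBlDl -{1}[(size B)%:R]mul1r -mulrDl.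
apply: le_trans (normR_triangle _ _ (\sum_(t <- B') g t)) _.
rewrite normR_distC; apply: le_trans (lerD h1 h2) _.
by rewrite le_eqVlt; apply/orP; left; apply/eqP; ring.
Qed.

(** The points are chosen one by one: if no further point were available, finitely many translates
    of [D] would cover the group and make it compact. *)
Lemma exists_spread (D : set G) (N : nat) : compact D -> ~ compact [set: G] ->
  exists us : seq G, size us = N /\ pairwise (fun u v => `[< ~ D (u - v) >]) us.
Proof.
move=> cD ncG; elim: N => [|N [us [sus pus]]]; first by exists [::].
suff [v hv] : exists v, forall u, u \in us -> ~ D (v - u).
  exists (v :: us); split; first by rewrite /= sus.
  by rewrite /= pus andbT; apply/allP => u /hv ?; exact/asboolP.
apply/not_existsP => h; apply: ncG.
have -> : [set: G] = \big[setU/set0]_(u <- us) [set d + u | d in D].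
  apply/seteqP; split => // v _.
  have /existsNP[u /not_implyP[uus /contrapT Dvu]] := h v.
  rewrite -bigcup_seq; exists u => //=; exists (v - u) => //; exact: subrK.
apply: bigsetU_compact => u _; apply: continuous_compact => //.
apply: continuous_subspaceT => d.
by have := @continuous_subr G (- u) d; rewrite /continuous_at;
  under eq_fun do rewrite opprK; rewrite opprK.
Qed.

(** At most one of the translates u + B contains points satisfying [P]. *)
Lemma count_spread (us B : seq G) (P : pred G) :
  pairwise (fun u v => ~~ (has (fun b => P (u + b)) B && has (fun b => P (v + b)) B)) us ->
  (count P [seq (u + b)%R | u <- us, b <- B] <= size B)%N.
Proof.
elim: us => [//|u us ih] /= /andP[/allP hu pus].
rewrite count_cat; have [hasu|hasu] := boolP (has (fun b => P (u + b)) B).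
  rewrite (_ : count P (flatten _) = 0%N) ?addn0.
    by rewrite (leq_trans (count_size _ _))// size_map.
  apply/eqP; rewrite -leqn0 leqNgt -has_count; apply/negP.
  move=> /hasP[_ /allpairsP[[v b] [/= vus bB ->]] Pvb].
  by have := hu v vus; rewrite hasu /= => /hasPn/(_ b bB); rewrite Pvb.
rewrite (_ : count P (map _ _) = 0%N) ?add0n ?ih//.
by apply/eqP; rewrite -leqn0 leqNgt -has_count has_map.
Qed.

(* For nonempty K the set F is a union of translates u + B of a Folner set B, so
   far apart that a translate of K meets at most one of them. *)
Lemma exists_folner_spread (K : set G) (s : seq G) (e : R) : compact K ->
  K = set0 \/ ~ compact [set: G] -> 0 < e ->
  exists F : seq G, [/\ uniq F, F != [::],
    forall y, (count (fun t => `[< K (y + t) >]) F)%:R <= e * (size F)%:R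
    & forall (g : G -> X) (M : R), 0 <= M -> (forall t, normR (g t) <= M) ->
        forall x, x \in s ->
        normR (\sum_(t <- F) g (t - x) - \sum_(t <- F) g t) <= e * M * (size F)%:R].
Proof.
move=> cK KG e0.
(* [folner_sum] doubles the constant, hence e / 2. *)
have [B [B' [[uB uB'] B0 BB' sB' eB]]] := exists_folner s (divr_gt0 e0 (ltr0n _ 2)).
have sB (g : G -> X) (M : R) x : 0 <= M -> (forall t, normR (g t) <= M) -> x \in s ->
    normR (\sum_(t <- B) g (t - x) - \sum_(t <- B) g t) <= e * M * (size B)%:R.
  move=> M0 gM xs; rewrite -[e in leRHS](divfK (_ : 2 != 0 :> R))// [e / 2 * 2]mulrC.
  exact: (folner_sum uB uB' BB' sB').
case: KG => [K0|ncG].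
  exists B; split => // y.
    have /eqP -> : count (fun t => `[< K (y + t) >]) B == 0%N.
      rewrite -leqn0 leqNgt -has_count; apply/hasPn => b _.
      by apply/asboolPn; rewrite K0.
    by rewrite mulr0n mulr_ge0// ltW.
  by move=> M M0 gM x xs; exact: sB.
(* Adjoining 0 to [K] lets one set handle two demands: with k = 0, disjointness of the translates of
   [B]; with k in [K], that a translate of [K] meets at most one of them. *)
pose E : set G := [set x.1 - x.2 | x in [set` B] `*` (K `|` [set 0])].
have cB : compact [set` B].
  have -> : [set` B] = \big[setU/set0]_(b <- B) [set b].
    by rewrite -bigcup_seq; apply/seteqP; split => [b bB|b [c cB ->]] //; exists b.
  by apply: bigsetU_compact => b _; exact: compact_set1.
have cE : compact E by apply: compactB => //; apply: compactU => //; exact: compact_set1.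
(* As N > 1/e, one copy of [B] makes up at most the proportion [e] of N copies. *)
pose N := (Num.bound e^-1).+1.
have [us [sus pus]] := exists_spread N (compactB cE cE) ncG.
(* Indeed u - v = (b' - k') - (b - k) is then a difference of two elements of [E]. *)
have disj u v b b' k k' : b \in B -> b' \in B -> (K `|` [set 0]) k -> (K `|` [set 0]) k' ->
    u + b - k = v + b' - k' -> [set x.1 - x.2 | x in E `*` E] (u - v).
  move=> bB bB' Kk Kk' h; exists (b' - k', b - k) => /=.
    by split; [exists (b', k')|exists (b, k)].
  rewrite -[u](addrK (b - k)) [u + _]addrA h -[v + b' - k']addrA [v + _]addrC.
  by rewrite [X in _ = X - v]addrAC addrK.
have sep u v b b' k k' : u \in us -> v \in us -> b \in B -> b' \in B ->
    (K `|` [set 0]) k -> (K `|` [set 0]) k' -> u + b - k = v + b' - k' -> u = v.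
  move=> /(nthP 0)[i iN <-] /(nthP 0)[j jN <-] bB bB' Kk Kk' h.
  have /(pairwiseP 0) pP := pus.
  case: (ltngtP i j) => [ij|ji|-> //].
    by have /asboolW := pP i j iN jN ij; have := disj _ _ _ _ _ _ bB bB' Kk Kk' h.
  by have /asboolW := pP j i jN iN ji; have := disj _ _ _ _ _ _ bB' bB Kk' Kk (esym h).
have zK : (K `|` [set 0]) 0 by right.
have [b0 b0B] : exists b, b \in B.
  by case: B B0 {sB uB BB' sB' eB cB E cE us sus pus disj sep} => // b B _; exists b; rewrite mem_head.
have uus : uniq us.
  apply: pairwise_uniq pus => u; apply/asboolPn; apply.
  exact: (disj u u b0 b0 0 0).
have size_F : size [seq (u + b)%R | u <- us, b <- B] = (N * size B)%N.
  by rewrite size_allpairs sus.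
exists [seq (u + b)%R | u <- us, b <- B]; split.
- apply: allpairs_uniq => //.
  move=> [u b] [v c] /allpairsP[[u' b'] [/= uu bB [-> ->]]]
    /allpairsP[[v' c'] [/= vv cB' [-> ->]]] /= h.
  have uv : u' = v' by apply: (sep u' v' b' c' 0 0) => //; rewrite !subr0.
  by move: h; rewrite uv => /addrI ->.
- by rewrite -size_eq0 size_F muln_eq0 negb_or /= size_eq0.
- move=> y; rewrite size_F natrM.
  apply: (@le_trans _ _ (size B)%:R).
    rewrite ler_nat; apply: count_spread.
    apply: (sub_in_pairwise (P := mem us)) pus; last exact/allP.
    move=> u v uu vv /asboolW nD; apply/negP.
    move=> /andP[/hasP[b bB /asboolW Kb] /hasP[c cB' /asboolW Kc]].
    (* With these elements of [K], both sides of the equation required by [disj] equal - y. *)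
    apply: nD; apply: (disj u v b c (y + (u + b)) (y + (v + c))) => //;
      [by left|by left|].
    by rewrite ![y + _]addrC ![- (_ + y)]opprD ![_ + (_ - y)]addrA !subrr.
  rewrite mulrA -{1}[(size B)%:R]mul1r ler_wpM2r//.
  have e1 : 0 <= e^-1 by rewrite invr_ge0 ltW.
  rewrite -ler_pdivrMl// mulr1; apply: le_trans (ltW (archi_boundP e1)) _.
  by rewrite ler_nat.
(* The estimate for [B] is applied to g(u + .) for each [u] and summed. *)
- move=> g M M0 gM x xs; rewrite !big_allpairs_dep -sumrB size_F natrM.
  apply: le_trans (normR_sum _ _ _) _.
  rewrite mulrCA -[N in leRHS]sus -sum1_size natr_sum mulr_suml.
  apply: ler_sum => u _; rewrite mul1r.
  have := sB (fun b => g (u + b)) M x M0 (fun t => gM _) xs => /=.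
  by under eq_bigr do rewrite addrA.
Qed.

End Folner.

(** * Averages of the convolution *)

Section Ergodic.
Context {R : realType} {G : topologicalZmodType}.
Context {mu : {measure set (borel G) -> \bar R}} {w : G -> R}.
Hypotheses (hG : hausdorff_space G) (cgG : compactly_generated G).
Hypothesis ww : is_weight w.
Context {X : completeNormedModType R[i]}.

Lemma weight_compact_eq1 : compact [set: G] -> forall t, w t = 1.
Proof.
move=> cG; apply: (weight_bounded ww).
have : bounded_set [set w x | x in [set: G]].
  apply: compact_bounded; apply: continuous_compact => //.
  by apply: continuous_subspaceT => x; exact: weight_continuous ww x.
move=> [M [Mr hM]]; exists (M + 1) => t; apply: le_trans (ler_norm _) _.
by apply: (hM (M + 1)); [rewrite ltrDl|exists t].
Qed.

(** For w = 1 the differences vanish and the empty set will do. Otherwise the group is not compact,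
    since a continuous weight on a compact group is bounded, hence 1. This is the alternative that
    [exists_folner_spread] asks for. *)
Lemma weight_difference_small_off (s : seq G) (d : R) : 0 < d ->
  exists K : set G, [/\ compact K, K = set0 \/ ~ compact [set: G]
    & forall y x, ~ K y -> x \in s -> `|difference x w y / w y| <= d].
Proof.
move=> d0; have [w1|/existsNP[t wt]] := pselect (forall t, w t = 1).
  exists set0; split; [exact: compact0|by left|] => y x _ _.
  by rewrite /difference /translate !w1 subrr mul0r normr0 ltW.
have ncG : ~ compact [set: G] by move=> /weight_compact_eq1/(_ t).
have /choice[K hK] x : exists K : set G, compact K /\
    forall y, ~ K y -> `|difference x w y / w y| <= d.
  have [_ /(_ d d0)[K cK hK]] := weight_difference_C0 ww x.
  by exists K; split => // y /hK/ltW.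
exists (\big[setU/set0]_(x <- s) K x); split; [|by right|].
  by apply: bigsetU_compact => x _; exact: (hK x).1.
move=> y x nK xs; apply: (hK x).2 => Ky; apply: nK.
by rewrite -bigcup_seq; exists x.
Qed.

Variables (phi : G -> X) (f : G -> R[i]).
Hypotheses (phiB : BUC_w w phi) (Lf : L1_w mu w f) (f0 : complex_integral mu f = 0).

Let psi := convolution mu phi f.
Let step (s : seq (R[i] * G)) y : X := \sum_(c <- s) c.1 *: phi (y - c.2).

(** Finite sums of translates of [phi] are continuous and w-bounded; the approximation by them is
    uniform relative to [w], so both properties pass to the convolution. *)
Lemma convolution_BC : BC_w w psi.
Proof.
have [M M0 hM] := BC_wP ww phiB.1.
have sumE := convolution_sum_approx hG cgG ww phiB Lf f0.
split.
  move=> y0; apply/cvg_normRP/(@cvgrPdist_le _ R^o) => e e0.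
  (* Near [y0] one has w y <= w y0 + 1, so the errors at [y] and [y0] together are at most e / 3. *)
  pose d := e / (3 * (2 * w y0 + 1)).
  have w0 : 0 < 3 * (2 * w y0 + 1) by rewrite mulr_gt0// addr_gt0// mulr_gt0// (weight_gt0 ww).
  have d0 : 0 < d by rewrite divr_gt0.
  have [s [hs _]] := sumE d d0.
  have cstep : continuous (step s).
    rewrite /step; elim: s {hs} => [|c s ih] y.
      by under eq_fun do rewrite big_nil; exact: cvg_cst.
    under eq_fun do rewrite big_cons; apply: cvgD; last exact: ih.
    apply: cvgZr; apply: (@cvg_comp _ _ _ (fun y => y - c.2) phi).
      exact: continuous_subr.
    exact: (phiB.1.1 (y - c.2)).
  have e3 : 0 < e / 3 by rewrite divr_gt0.
  have /cvg_normRP/cvgrPdist_le/(_ _ e3) near1 := cstep y0.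
  have /cvgrPdist_le/(_ _ ltr01) near2 := weight_continuous ww (x := y0).
  near=> y; rewrite sub0r normrN ger0_norm ?normR_ge0//.
  have n1 : normR (step s y - step s y0) <= e / 3.
    have : `|0 - normR (step s y - step s y0)| <= e / 3 by near: y.
    by rewrite sub0r normrN ger0_norm ?normR_ge0.
  have n2 : w y <= w y0 + 1.
    have : `|w y0 - w y| <= 1 by near: y.
    by rewrite ler_norml => /andP[h _]; rewrite -lerBlDl -lerN2 opprB.
  have h1 := hs y; have h2 := hs y0; rewrite normR_distC in h2.
  have t1 := normR_triangle (psi y) (psi y0) (step s y).
  have t2 := normR_triangle (step s y) (psi y0) (step s y0).
  have dE : d * (2 * w y0 + 1) = e / 3.
    by rewrite /d invfM mulrA divfK// gt_eqF// addr_gt0// mulr_gt0// (weight_gt0 ww).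
  have : d * w y + d * w y0 <= e / 3.
    by rewrite -dE -mulrDr ler_wpM2l ?(ltW d0)//; lra.
  rewrite -/psi in h1 h2; rewrite -/(step s y) in h1; rewrite -/(step s y0) in h2; lra.
have [s [hs _]] := sumE 1 ltr01.
pose Z := \sum_(c <- s) normR c.1 * (M * w c.2).
suff : (wsup_norm w psi <= (1 + Z)%:E)%E by move=> /le_lt_trans; apply; exact: ltry.
apply: (wsup_norm_le ww) => y.
have := normRD (psi y - step s y) (step s y); rewrite subrK => /le_trans; apply.
rewrite mulrDl lerD//.
apply: le_trans (normR_sum _ _ _) _; rewrite mulr_suml; apply: ler_sum => c _.
rewrite normRZ -mulrA ler_wpM2l ?normR_ge0//.
by rewrite (le_trans (hM _))// -mulrA ler_wpM2l// mulrC (weight_subB ww).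
Unshelve. all: by end_near.
Qed.

Let Psi t : X := (w t)%:C^-1 *: phi t.

(** The sum comes from dividing each phi(y - x) by its own weight instead of w(y). With D = w(y - x)
    - w(y), 1/w(y) - 1/w(y - x) = (D / w(y)) / w(y - x), and the last factor is absorbed by |phi(y -
    x)| <= M w(y - x). *)
Lemma convolution_step_error (s : seq (R[i] * G)) (d : R) y (M : R) :
  (forall t, normR (phi t) <= M * w t) ->
  normR (psi y - step s y) <= d * w y ->
  normR ((w y)%:C^-1 *: psi y - \sum_(c <- s) c.1 *: Psi (y - c.2)) <=
  d + \sum_(c <- s) normR c.1 * (M * `|difference (- c.2) w y / w y|).
Proof.
move=> hM hs; have wy := weight_gt0 ww y.
have nw t : normR ((w t)%:C^-1 : R[i]) = (w t)^-1.
  by rewrite normRV normR_real gtr0_norm// (weight_gt0 ww).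
apply: le_trans (normR_triangle _ _ ((w y)%:C^-1 *: step s y)) _; apply: lerD.
  by rewrite -scalerBr normRZ nw mulrC ler_pdivrMr.
rewrite /step scaler_sumr -sumrB.
apply: le_trans (normR_sum _ _ _) _; apply: ler_sum => c _.
rewrite scalerA mulrC -scalerA -scalerBr normRZ ler_wpM2l ?normR_ge0//.
rewrite /Psi -scalerBl normRZ.
have wz := weight_gt0 ww (y - c.2).
have -> : ((w y)%:C^-1 - (w (y - c.2))%:C^-1 : R[i]) =
    ((w y)^-1 - (w (y - c.2))^-1)%:C by rewrite rmorphB !fmorphV.
rewrite normR_real.
have -> : (w y)^-1 - (w (y - c.2))^-1 = difference (- c.2) w y / w y / w (y - c.2).
  by rewrite /difference /translate; field; rewrite !gt_eqF.
rewrite normrM (gtr0_norm (_ : 0 < (w (y - c.2))^-1)) ?invr_gt0//.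
rewrite -mulrA mulrC ler_wpM2r//.
by rewrite mulrC ler_pdivrMr.
Qed.

Lemma convolution_E0 : E0_w w psi.
Proof.
split; first exact: convolution_BC.
move=> e e0; have [M M0 hM] := BC_wP ww phiB.1.
have M1 : 0 < 1 + M by rewrite ltr_wpDr.
(* Then 2 d + d M <= 2 d (1 + M) = e / 4. *)
pose d := e / (8 * (1 + M)).
have d0 : 0 < d by rewrite divr_gt0// mulr_gt0.
have [s [hs hc]] := convolution_sum_approx hG cgG ww phiB Lf f0 d0.
pose C := \sum_(c <- s) normR c.1.
have C0 : 0 <= C by apply: sumr_ge0 => c _; exact: normR_ge0.
have CM1 : 0 < 1 + C * M by rewrite ltr_wpDr// mulr_ge0.
(* Off [K] the change of weights then costs at most C M d' <= d. *)
pose d' := d / (1 + C * M).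
have d'0 : 0 < d' by rewrite divr_gt0.
have [K [cK KG hK]] := weight_difference_small_off [seq - c.2 | c <- s] d'0.
(* Bound for the change of weights on [K], where only |w(y - x) - w(y)| <= (1 + w(x)) w(y) is
   available. *)
pose Z := \sum_(c <- s) normR c.1 * (M * (1 + w c.2)).
have Z0 : 0 <= Z.
  apply: sumr_ge0 => c _; rewrite !mulr_ge0 ?normR_ge0 ?addr_ge0//.
  exact/ltW/(weight_gt0 ww).
have ZCM : 0 < 1 + Z + C * M by rewrite ltr_wpDr ?mulr_ge0// ltr_wpDr.
(* Covers the points in [K], of proportion at most e' and error [Z], and the Folner errors, at most
   e' C M: together at most e / 4. *)
pose e' := e / 4 / (1 + Z + C * M).
have e'0 : 0 < e' by rewrite !divr_gt0.
have [F [uF F0 countF sumF]] := exists_folner_spread (X := X) [seq c.2 | c <- s] cK KG e'0.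
have PsiM t : normR (Psi t) <= M.
  rewrite /Psi normRZ normRV normR_real gtr0_norm ?(weight_gt0 ww)//.
  by rewrite mulrC ler_pdivrMr// (weight_gt0 ww).
pose E y := (w y)%:C^-1 *: psi y - \sum_(c <- s) c.1 *: Psi (y - c.2).
have hE y : normR (E y) <= 2 * d + `[< K y >]%:R * Z.
  apply: le_trans (convolution_step_error hM (hs y)) _.
  case: asboolP => Ky; rewrite ?mul1r ?mul0r ?addr0.
    rewrite lerD//; first by rewrite ler_peMl// ?ltW// ltr1n.
    apply: ler_sum => c _; rewrite ler_wpM2l ?normR_ge0// ler_wpM2l//.
    have wy := weight_gt0 ww y.
    rewrite normrM normfV (gtr0_norm wy) ler_pdivrMr// (le_trans (ler_normB _ _))//.
    rewrite /translate !gtr0_norm ?(weight_gt0 ww)// mulrDl mul1r addrC lerD2l.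
    by rewrite mulrC (weight_subB ww).
  rewrite [2 * d]mulr_natl mulr2n lerD2l.
  apply: (@le_trans _ _ (C * M * d')); last first.
    by rewrite /d' mulrCA ler_piMr ?(ltW d0)// ler_pdivrMr// mul1r lerDr.
  rewrite /C !mulr_suml !big_seq; apply: ler_sum => c cs.
  rewrite -mulrA ler_wpM2l ?normR_ge0// ler_wpM2l//.
  by apply: hK => //; apply: map_f.
pose n := (size F)%:R : R.
have n0 : 0 < n by rewrite ltr0n lt0n size_eq0.
have avg y : normR (\sum_(t <- F) (w (y + t))%:C^-1 *: psi (y + t)) <= e / 2 * n.
  (* Three terms: the approximation error, the effect of shifting the sums of [Psi], and the small
     total coefficient times the unshifted sum. *)
  have -> : \sum_(t <- F) (w (y + t))%:C^-1 *: psi (y + t) =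
      \sum_(t <- F) E (y + t) + (\sum_(c <- s) c.1 *:
        (\sum_(t <- F) Psi (y + (t - c.2)) - \sum_(t <- F) Psi (y + t)) +
       (\sum_(c <- s) c.1) *: \sum_(t <- F) Psi (y + t)).
    under [in RHS]eq_bigr do rewrite /E.
    rewrite sumrB -addrA -[LHS]addr0; congr (_ + _); apply/esym/eqP.
    rewrite addrC subr_eq0 exchange_big /= scaler_suml -big_split /=; apply/eqP.
    apply: eq_bigr => c _; rewrite -scalerDr subrK -scaler_sumr.
    by congr (_ *: _); apply: eq_bigr => t _; rewrite addrA.
  have b1 : normR (\sum_(t <- F) E (y + t)) <= 2 * d * n + e' * n * Z.
    apply: le_trans (normR_sum _ _ _) _.
    apply: (@le_trans _ _ (\sum_(t <- F) (2 * d + `[< K (y + t) >]%:R * Z))).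
      by apply: ler_sum => t _; exact: hE.
    rewrite big_split /= lerD//.
      by rewrite big_const_seq iter_addr_0 count_predT -[leLHS]mulr_natr.
    rewrite -mulr_suml ler_wpM2r//.
    apply: le_trans (countF y); rewrite -sum1_count natr_sum [leRHS]big_mkcond.
    by apply: ler_sum => t _; case: asboolP.
  have b2 : normR (\sum_(c <- s) c.1 *:
        (\sum_(t <- F) Psi (y + (t - c.2)) - \sum_(t <- F) Psi (y + t))) <= C * (e' * M * n).
    apply: le_trans (normR_sum _ _ _) _; rewrite /C mulr_suml big_seq [leRHS]big_seq.
    apply: ler_sum => c cs; rewrite normRZ ler_wpM2l ?normR_ge0//.
    exact: (sumF (fun t => Psi (y + t)) M M0 (fun t => PsiM _) c.2 (map_f _ cs)).
  have b3 : normR ((\sum_(c <- s) c.1) *: \sum_(t <- F) Psi (y + t)) <= d * (M * n).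
    rewrite normRZ ler_pM ?normR_ge0//; apply: le_trans (normR_sum _ _ _) _.
    apply: (@le_trans _ _ (\sum_(t <- F) M)); first by apply: ler_sum.
    by rewrite big_const_seq iter_addr_0 count_predT -[leLHS]mulr_natr.
  apply: le_trans (normRD _ _) _.
  apply: le_trans (lerD b1 (le_trans (normRD _ _) (lerD b2 b3))) _.
  have dE : d * (1 + M) = e / 8 by rewrite /d invfM mulrA divfK// gt_eqF.
  have e'E : e' * (1 + Z + C * M) = e / 4 by rewrite /e' divfK// gt_eqF.
  rewrite [leLHS](_ : _ = (2 * d + d * M + e' * (Z + C * M)) * n); last by ring.
  rewrite ler_wpM2r ?ltW//.
  have dM : 0 <= d * M by rewrite mulr_ge0// ltW.
  lra.
pose F' := [fset t | t in F]%fset.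
have pF : perm_eq F' F.
  by apply: uniq_perm => // t; rewrite !inE.
have cF : #|` F'| = size F by exact: perm_size.
exists F'; first by rewrite -cardfs_gt0 cF lt0n size_eq0.
(* The bound e / 2 leaves room for the strict inequality demanded of the supremum. *)
apply: (@le_lt_trans _ _ (e / 2)%:E); last first.
  by rewrite lte_fin ltr_pdivrMr// ltr_pMr// ltr1n.
apply: ge_ereal_sup => _ [y _ <-]; rewrite lee_fin normRZ normRV cF (perm_big _ pF)/=.
rewrite -(rmorph_nat (real_complex R)) normR_real gtr0_norm//.
by rewrite mulrC ler_pdivrMr.
Qed.

End Ergodic.

(** * Multiplication by a character *)

Section Twist.
Context {R : realType} {G : topologicalZmodType}.
Context {mu : {measure set (borel G) -> \bar R}} {w : G -> R}.
Hypothesis ww : is_weight w.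
Variable gamma : dual_group R G.

Lemma dual_characterP : is_character (dual_fun gamma).
Proof. exact: (set_valP gamma). Qed.

Lemma characterD (s t : G) : gamma (s + t) = gamma s * gamma t.
Proof. by have [_ + _] := dual_characterP; exact. Qed.

Lemma character0 : gamma 0 = 1.
Proof.
have [_ _ gN]  := dual_characterP.
have g00 : gamma 0 != 0 by rewrite -normr_eq0 (gN 0) oner_eq0.
by apply: (mulfI g00); rewrite mulr1 -characterD addr0.
Qed.

Lemma characterV t : (gamma t)^-1 = gamma (- t).
Proof.
have [_ _ gN]  := dual_characterP.
have gt0 : gamma t != 0 by rewrite -normr_eq0 (gN t) oner_eq0.
by apply: (mulfI gt0); rewrite divff// -characterD subrr character0.
Qed.

Lemma normR_character t : normR (gamma t) = 1.
Proof.
have [_ _ gN]  := dual_characterP.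
by rewrite /normR (gN t).
Qed.

(** [u] is 1-Lipschitz, so its composite with the continuous character is continuous; this is meant
    for real and imaginary parts. *)
Lemma character_measurable (u : R[i] -> R) :
  (forall x y, `|u x - u y| <= normR (x - y)) ->
  measurable_fun setT ((fun t => u (gamma (- t))) : borel G -> R).
Proof.
move=> hu; apply: continuous_borel => t.
have [gc _ gN]  := dual_characterP.
have gt : normR (gamma (- s) - gamma (- t)) @[s --> t] --> (0 : R).
  apply/(cvg_normRP (X := R[i]^o)).
  apply: (@cvg_comp _ _ _ -%R gamma); last exact: (gc (- t)).
  exact: opp_continuous.
apply/cvgrPdist_le => e e0.
move/cvgrPdist_le/(_ _ e0): gt; apply: filterS => s.
rewrite sub0r normrN ger0_norm ?normR_ge0//; apply: le_trans.
by rewrite distrC.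
Qed.

Lemma L1_w_twist (f : G -> R[i]) : L1_w mu w f ->
  L1_w mu w (fun t => gamma (- t) * f t).
Proof.
move=> Lf; have [f1 f2 f3] := Lf.
have ReB (x y : R[i]) : `|complex.Re x - complex.Re y| <= normR (x - y).
  by rewrite -raddfB; exact: normR_Re.
have ImB (x y : R[i]) : `|complex.Im x - complex.Im y| <= normR (x - y).
  by rewrite -raddfB; exact: normR_Im.
have [mr mi] := (character_measurable ReB, character_measurable ImB).
apply: (L1_w_le ww (C := 1) Lf).
- have -> : (fun t => complex.Re (gamma (- t) * f t)) =
     (fun t => complex.Re (gamma (- t)) * complex.Re (f t)
        - complex.Im (gamma (- t)) * complex.Im (f t)).
    by apply/funext => t; case: (gamma (- t)) => ? ?; case: (f t).
  by apply: measurable_funB; exact: measurable_funM.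
- have -> : (fun t => complex.Im (gamma (- t) * f t)) =
     (fun t => complex.Re (gamma (- t)) * complex.Im (f t)
        + complex.Im (gamma (- t)) * complex.Re (f t)).
    by apply/funext => t; case: (gamma (- t)) => ? ?; case: (f t).
  by apply: measurable_funD; exact: measurable_funM.
- by move=> t; rewrite normRM normR_character.
Qed.

(** The transform of [fn n] vanishes at [gamma], which lies in [Delta], and the transform at a point
    is continuous for the weighted norm. *)
Lemma fourier_spectral_synthesis (f : G -> R[i]) (Delta : set (dual_group R G)) :
  L1_w mu w f -> spectral_synthesis mu w f Delta -> Delta gamma ->
  fourier mu f gamma = 0.
Proof.
move=> Lf [fn [Lfn fnf fn0]] Dg.
have h n : ((normR (fourier mu f gamma))%:E <=
    2%:E * w1_norm mu w (fun t => fn n t - f t)%R)%E.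
  have f0 : fourier mu (fn n) gamma = 0.
    by have [U UD] := fn0 n; apply; apply: nbhs_singleton; exact: UD.
  have := complex_integralB ww (L1_w_twist (Lfn n)) (L1_w_twist Lf).
  rewrite -/(fourier mu (fn n) gamma) -/(fourier mu f gamma) f0 sub0r normRN.
  move=> /le_trans; apply; rewrite le_eqVlt; apply/orP; left; apply/eqP.
  congr (_ * _)%E; apply: eq_integral => t _.
  by rewrite -mulrBr normRM normR_character mul1r.
have lim0 : (2%:E * w1_norm mu w (fun t => fn n t - f t)%R)%E @[n --> \oo] --> (2%:E * 0%E : \bar R)%E.
  exact: cvgeZl.
have := cvge_to_ge lim0 (nearW _ h); rewrite mule0 lee_fin => h0.
by apply/eqP; rewrite -normR_eq0 eq_le h0 normR_ge0.
Qed.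

Lemma BUC_w_twist (X : normedModType R[i]) (phi : G -> X) : BUC_w w phi ->
  BUC_w w (fun t => gamma (- t) *: phi t).
Proof.
move=> phiB; have [[phic phib] phiu] := phiB; have [M M0 hM] := BC_wP ww phiB.1.
have [gc _ gN]  := dual_characterP.
split; first split.
- move=> t; apply: (@cvgZ _ _ _ (nbhs t)); last exact: phic.
  apply: (@cvg_comp _ _ _ -%R gamma); last exact: (gc (- t)).
  exact: opp_continuous.
- apply: (@le_lt_trans _ _ M%:E); last exact: ltry.
  by apply: (wsup_norm_le ww) => t; rewrite normRZ normR_character mul1r.
have gV : normR (gamma (- h) - 1) @[h --> (0 : G)] --> (0 : R).
  apply/(cvg_normRP (X := R[i]^o)).
  apply: (@cvg_comp _ _ _ -%R gamma); last first.
    by rewrite -character0 -oppr0; exact: (gc (- 0)).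
  exact: opp_continuous.
apply: (@squeeze_cvge _ _ _ _ (fun=> 0%E) _
  (fun h => wsup_norm w (difference h phi) + (normR (gamma (- h) - 1) * M)%:E)%E).
- apply: nearW => h; apply/andP; split.
    apply: (@le_trans _ _ (normR (difference h (fun t => gamma (- t) *: phi t) 0) / w 0)%:E).
      by rewrite lee_fin divr_ge0 ?normR_ge0// ltW// (weight_gt0 ww).
    by apply: ereal_sup_ubound; exists 0.
  apply: ge_ereal_sup => _ [t _ <-].
  apply: (@le_trans _ _ ((normR (difference h phi t) / w t)%:E
      + (normR (gamma (- h) - 1) * M)%:E)%E); last first.
    by rewrite leeD2r//; apply: ereal_sup_ubound; exists t.
  have wt := weight_gt0 ww t.
  rewrite -EFinD lee_fin ler_pdivrMr// mulrDl divfK ?gt_eqF// /difference /translate.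
  (* Product rule for differences: one term is small because [phi] is w-uniformly continuous, the
     other because [gamma] is continuous at 0. *)
  have -> : gamma (- (t + h)) *: phi (t + h) - gamma (- t) *: phi t =
      gamma (- t) *: (gamma (- h) *: (phi (t + h) - phi t) + (gamma (- h) - 1) *: phi t).
    rewrite opprD characterD scalerBr scalerBl scale1r addrA subrK scalerBr scalerA.
    by [].
  rewrite normRZ normR_character mul1r (le_trans (normRD _ _))// !normRZ normR_character mul1r.
  by rewrite lerD2l -mulrA ler_wpM2l ?normR_ge0.
- exact: cvg_cst.
- rewrite -[X in _ --> X](adde0 0%E); apply: cvgeD => //.
  apply: cvg_EFin; first exact: nearW.
  by rewrite -[X in _ --> X](mul0r M); apply: cvgMl.
Qed.

Lemma convolution_twist (X : completeNormedModType R[i]) (phi : G -> X) (f : G -> R[i]) t :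
  hausdorff_space G -> compactly_generated G -> BUC_w w phi -> L1_w mu w f ->
  (gamma t)^-1 *: convolution mu phi f t =
  convolution mu (fun s => gamma (- s) *: phi s) (fun s => gamma (- s) * f s) t.
Proof.
move=> hG cgG phiB Lf.
(* This supplies the existence of the integral at [t]. Multiplying it by gamma(-t) = gamma(-(t - x))
   gamma(-x) gives the twisted integrand. *)
have [q [_ _ _ bF _]] := convolution_steps hG cgG ww phiB Lf.
apply/esym/bochner_integralP.
have := is_bochner_integralZ (gamma t)^-1 (bF t).
congr (is_bochner_integral mu _ _); apply/funext => x.
rewrite !scalerA characterV mulrAC -characterD; congr (_ *: _).
by rewrite opprB addrA addNr add0r.
Qed.

End Twist.


Theorem corollary6p13 (R : realType) (G : topologicalZmodType)
    (G_lca : is_LCA G) (G_cg : compactly_generated G)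
    (mu : {measure set (borel G) -> \bar R}) (mu_haar : is_haar mu)
    (X : completeNormedModType R[i])
    (w : G -> R) (w_weight : is_weight w)
    (f : G -> R[i]) (f_L1 : L1_w mu w f)
    (Delta : set (dual_group R G)) (Delta_closed : closed Delta)
    (f_synth : spectral_synthesis mu w f Delta)
    (gamma : dual_group R G) (gamma_Delta : Delta gamma)
    (phi : G -> X) (phi_BUC : BUC_w w phi) :
  E0_w w (fun t => (gamma t)^-1 *: convolution mu phi f t).
Proof.
have [hG _] := G_lca.
have -> : (fun t => (gamma t)^-1 *: convolution mu phi f t) =
    convolution mu (fun s => gamma (- s) *: phi s) (fun s => gamma (- s) * f s).
  by apply/funext => t; exact: convolution_twist hG G_cg phi_BUC f_L1.
(* The condition that the twisted function has integral 0 says that the Fourier transform of [f]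
   vanishes at [gamma]. *)
apply: (convolution_E0 hG G_cg w_weight).
- exact: BUC_w_twist.
- exact: L1_w_twist.
- exact: fourier_spectral_synthesis f_synth gamma_Delta.
Qed.
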